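(* Let $g\colon\mathbb{S}^1\to\mathbb{S}^1$ be an orientation-preserving homeomorphism and let $\widetilde Z$, $Q$, $S_Z$ be as in the context. The following are quantitatively equivalent: (1) $g$ is $L$-bi-Lipschitz (with respect to $\sigma$); (2) there exists an $L'$-bi-Lipschitz homeomorphism $\Psi\colon\widetilde Z\to\mathbb{S}^2$; (3) there exists $C'\ge 0$ such that for every $y\in Q(S_Z)$, $$\liminf_{r\to0^+}\frac{\mathcal{H}^2_{\widetilde Z}(\overline{B}_{\widetilde Z}(y,r))}{\pi r^2}\le C'.$$ More precisely: (1) implies (2) with $L'=L$; (2) implies (3) with $C'=(L')^4$; (3) implies (1) with $L=\pi C'$.
   Context: Let $\mathbb{S}^2\subset\mathbb{R}^3$ be the unit sphere with the length (great-circle) distance $\sigma$, let $\mathbb{S}^1=\mathbb{S}^2\cap(\mathbb{R}^2\times\{0\})$ be the equator, and let $Z_1,Z_2$ be the open southern and northern hemispheres, with $(0,0,1)\in Z_2$. Given an orientation-preserving homeomorphism $g\colon\mathbb{S}^1\to\mathbb{S}^1$, let $Z$ be the set obtained from the disjoint union $\overline Z_1\sqcup\overline Z_2$ by identifying each $z\in\mathbb{S}^1\subset\overline Z_1$ with $g(z)\in\mathbb{S}^1\subset\overline Z_2$, with induced maps $\iota_i\colon\overline Z_i\to Z$, and seam $S_Z=\iota_1(\mathbb{S}^1)=\iota_2(\mathbb{S}^1)$. Define $D\colon Z\times Z\to[0,\infty]$ by: $D(x,y)=\infty$ if one of $x,y$ lies in $\iota_1(Z_1)$ and the other in $\iota_2(Z_2)$;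 $D(\iota_1(a),\iota_1(b))=\min\{\sigma(a,b),\sigma(g(a),g(b))\}$ for $a,b\in\mathbb{S}^1$; and otherwise (both points in $\iota_i(\overline Z_i)$ for a common $i$, not both on the seam) $D(x,y)=\sigma(\iota_i^{-1}(x),\iota_i^{-1}(y))$. Let $d_Z(x,y)=\inf\sum_{k=1}^n D(x_k,x_{k+1})$, the infimum over finite chains $x=x_1,\dots,x_{n+1}=y$ in $Z$. $d_Z$ is a pseudodistance; $\widetilde Z$ denotes the metric space obtained by identifying points at $d_Z$-distance zero, $Q\colon Z\to\widetilde Z$ the quotient map, $d_{\widetilde Z}$ the induced distance. $\mathcal{H}^2_{\widetilde Z}$ is the 2-dimensional Hausdorff measure on $\widetilde Z$ (normalized to agree with Lebesgue measure on $\mathbb{R}^2$) and $\overline B_{\widetilde Z}(y,r)$ the closed ball. *)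

(* Defs.v *)
From HB Require Import structures.
From mathcomp Require Import all_boot all_order all_algebra.
From mathcomp Require Import all_classical all_reals.
From mathcomp Require Import ereal topology normedtype sequences trigo.
Set Implicit Arguments.
Unset Strict Implicit.
Unset Printing Implicit Defensive.
Import Order.TTheory GRing.Theory Num.Theory.
Import numFieldNormedType.Exports.
Local Open Scope classical_set_scope.
Local Open Scope ring_scope.

Definition pt (R : realType) := (R * R * R)%type.
Definition px {R : realType} (a : pt R) : R := a.1.1.
Definition py {R : realType} (a : pt R) : R := a.1.2.
Definition pz {R : realType} (a : pt R) : R := a.2.
Definition dot {R : realType} (a b : pt R) : R :=
  px a * px b + py a * py b + pz a * pz b.

Definition S2 {R : realType} (a : pt R) : Prop := dot a a = 1.
Definition S1 {R : realType} (a : pt R) : Prop := S2 a /\ pz a = 0.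

Definition sigma {R : realType} (a b : pt R) : R := acos (dot a b).

Definition circ {R : realType} (t : R) : pt R := (cos t, sin t, 0).

Definition circle_homeo {R : realType} (g : pt R -> pt R) : Prop :=
  [/\ (forall a, S1 a -> S1 (g a)),
      (forall b, S1 b -> exists2 a, S1 a & g a = b),
      (forall a b, S1 a -> S1 b -> g a = g b -> a = b),
      (forall a e, S1 a -> 0 < e -> exists2 d, 0 < d &
          forall b, S1 b -> sigma a b < d -> sigma (g a) (g b) < e) &
      (forall a e, S1 a -> 0 < e -> exists2 d, 0 < d &
          forall b, S1 b -> sigma (g a) (g b) < d -> sigma a b < e)].

Definition orientation_preserving {R : realType} (g : pt R -> pt R) : Prop :=
  exists F : R -> R, [/\ continuous F,
    (forall s t, s < t -> F s < F t) &
    (forall t, g (circ t) = circ (F t))].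

Definition circle_biLip {R : realType} (g : pt R -> pt R) (L : R) : Prop :=
  forall a b, S1 a -> S1 b ->
    sigma a b <= L * sigma (g a) (g b) /\ sigma (g a) (g b) <= L * sigma a b.

(* The glued space Z.  Each point of Z has exactly one representative:
   (false, a) stands for iota_1(a), a in the closed southern hemisphere;
   (true, b)  stands for iota_2(b), b in the open northern hemisphere
   (points iota_2(b) with b on the equator equal iota_1(g^{-1} b)). *)
Definition inZ {R : realType} (p : bool * pt R) : Prop :=
  S2 p.2 /\ (if p.1 then 0 < pz p.2 else pz p.2 <= 0).
Definition Zpt (R : realType) := {p : bool * pt R | inZ p}.

Definition seam {R : realType} (x : Zpt R) : Prop :=
  (proj1_sig x).1 = false /\ pz (proj1_sig x).2 = 0.

Local Open Scope ereal_scope.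

Definition Dfun {R : realType} (g : pt R -> pt R) (x y : Zpt R) : \bar R :=
  let: (i, a) := proj1_sig x in
  let: (j, b) := proj1_sig y in
  match i, j with
  | false, false =>
      if (pz a == 0)%R && (pz b == 0)%R
      then (Order.min (sigma a b) (sigma (g a) (g b)))%:E
      else (sigma a b)%:E
  | false, true => if (pz a == 0)%R then (sigma (g a) b)%:E else +oo
  | true, false => if (pz b == 0)%R then (sigma a (g b))%:E else +oo
  | true, true => (sigma a b)%:E
  end.

Fixpoint chain_sum {R : realType} (g : pt R -> pt R) (x : Zpt R)
  (s : seq (Zpt R)) : \bar R :=
  match s with
  | [::] => 0
  | y :: s' => Dfun g x y + chain_sum g y s'
  end.

Definition dZ {R : realType} (g : pt R -> pt R) (x y : Zpt R) : \bar R :=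
  ereal_inf [set chain_sum g x s | s in
     [set s : seq (Zpt R) | (0 < size s)%N /\ last x s = y]].

Definition ediam {T : Type} {R : realType} (d : T -> T -> \bar R) (U : set T)
  : \bar R := ereal_sup ([set d x y | x in U & y in U] `|` [set 0]).

(* The delta-approximating 2-dimensional Hausdorff content, normalized so that
   it agrees with Lebesgue measure on R^2 (factor omega_2 / 2^2 = pi / 4). *)
Definition hausdorff2_delta {T : Type} {R : realType} (d : T -> T -> \bar R)
  (delta : R) (A : set T) : \bar R :=
  ereal_inf [set \sum_(i <oo) ((pi / 4 * (fine (ediam d (U i))) ^+ 2)%R)%:E
              | U in [set U : nat -> set T |
                       A `<=` \bigcup_i U i /\
                       forall i, ediam d (U i) <= delta%:E]].

Definition hausdorff2 {T : Type} {R : realType} (d : T -> T -> \bar R)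
  (A : set T) : \bar R :=
  ereal_sup [set hausdorff2_delta d delta A | delta in [set delta : R | (0 < delta)%R]].

Definition liminf0 {R : realType} (f : R -> \bar R) : \bar R :=
  ereal_sup [set ereal_inf [set f r | r in [set r : R | (0 < r < delta)%R]]
             | delta in [set delta : R | (0 < delta)%R]].

(* Preimage under Q of the closed ball of radius r around Q x in Z~. *)
Definition cballZ {R : realType} (g : pt R -> pt R) (x : Zpt R) (r : R)
  : set (Zpt R) := [set z | dZ g x z <= r%:E].

(* Psi : Z~ -> S^2 is an L'-bi-Lipschitz homeomorphism, expressed through
   psi = Psi o Q : Z -> S^2. *)
Definition biLip_homeo_to_S2 {R : realType} (g : pt R -> pt R)
  (psi : Zpt R -> pt R) (L : R) : Prop :=
  [/\ (forall x, S2 (psi x)),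
      (forall b, S2 b -> exists x, psi x = b) &
      (forall x y, (sigma (psi x) (psi y))%:E <= L%:E * dZ g x y /\
                   dZ g x y <= (L * sigma (psi x) (psi y))%:E)].

(* Main.v *)
(** (1) => (2): the northern hemisphere is mapped identically and the southern
    one by the cone extension of [g], which acts on longitudes by [g].  The
    cone extension is [L]-Lipschitz for chords because [sin (l t) <= l sin t],
    hence for arcs; between the hemispheres one goes through the point where
    the geodesic meets the equator.

    (2) => (3): pulling back covers, it is enough that a small spherical cap of
    radius [rho], i.e. a planar disc, has covers by arbitrarily small sets
    whose squared diameters add up to nearly [4 rho^2].  If [q] is the optimal
    cost of a unit square, inscribing discs gives [q <= 1 + (1 - s) q], where
    [s] is a lower Riemann sum for the fraction of the square in the disc, and
    covering a disc by squares costs [q] times its area: the area of the disc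
    cancels.

    (3) => (1): let [Phi] be a lift of [g] or of its inverse.  The ball of
    radius [r] about a seam point [tau] contains, in one hemisphere, the tent
    of points of longitude [Phi (tau + s)] and height at most [r - |s|].  If
    [Phi (tau + s) - Phi (tau - s) >= 2 M s] for all small [s], this tent has
    area about [M r^2], so by the isodiametric inequality the lower density at
    [tau] is at least [M / pi].  Hence for [M > pi C'] every point is the centre
    of arbitrarily short intervals on which [Phi] has mean slope at most [M],
    and Vitali's covering theorem makes [Phi] Lipschitz with constant [M]. *)

Require Import Defs.
From HB Require Import structures.
From mathcomp Require Import all_boot all_order all_algebra.
From mathcomp Require Import all_classical all_reals.
From mathcomp Require Import ereal topology normedtype sequences trigo.
From mathcomp Require Import derive realfun measure measurable_realfun.
From mathcomp Require Import lebesgue_measure numfun lebesgue_integral ftc.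
From mathcomp Require Import vitali_lemma ring lra.
Import Order.TTheory GRing.Theory Num.Theory.
Import numFieldNormedType.Exports.
Local Open Scope classical_set_scope.
Local Open Scope ring_scope.
Set Implicit Arguments.
Unset Strict Implicit.
Unset Printing Implicit Defensive.

(** * The unit sphere *)

(** The constants of all three implications are prescribed, so no step may lose a fixed factor.
    Arcs, chords and projections are therefore compared up to powers of a parameter [k < 1], at
    scales of order [1 - k], and [k] tends to 1 only at the very end, through [exists_pow_close].

    Two-dimensional Lebesgue measure never appears: both density bounds work on the covers
    themselves. In the upper bound [pi / 4] is a mere normalizing factor; in the lower bound it is
    the limit of Riemann sums of a quarter circle. The exponent in [L' ^+ 4] is 2 + 2: a ball of
    radius [r] goes into a cap of radius [L' r], and covers of that cap are pulled back with
    dilation [L'].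

    Vitali's theorem has to be applied to values. On the parameter line it would leave a null set
    uncovered, and a singular increasing function may map such a set onto one of positive
    measure. *)

Lemma sin_le_id (R : realType) (x : R) : 0 <= x -> sin x <= x.
Proof.
rewrite le_eqVlt => /orP[/eqP<-|x0]; first by rewrite sin0.
have [c _] := @MVT_segment R sin cos 0 x (ltW x0) (fun y _ => is_derive_sin y)
  (continuous_subspaceT (@continuous_sin R)).
by rewrite sin0 !subr0 => ->; rewrite ler_piMl ?cos_le1// ltW.
Qed.

Lemma cos_ge_1B (R : realType) (x : R) : 1 - x ^+ 2 / 2 <= cos x.
Proof.
have -> : cos x = 1 - (sin (x / 2)) ^+ 2 *+ 2.
  rewrite {1}(_ : x = (x / 2) *+ 2); last by rewrite -mulr_natr divfK.
  by rewrite cos_mulr2n cos2sin2; lra.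
have : (sin (x / 2)) ^+ 2 <= (x / 2) ^+ 2; last by nra.
have [x0|x0] := leP 0 x.
  have [xpi|xpi] := leP (x / 2) pi.
    rewrite ler_sqr ?nnegrE ?sin_le_id ?divr_ge0 ?sin_ge0_pi ?xpi ?divr_ge0//.
  apply: (@le_trans _ _ 1); first by have := cos2Dsin2 (x / 2); nra.
  by have := @pi_ge2 R; nra.
rewrite -sqrrN -[leRHS]sqrrN -sinN.
have [xpi|xpi] := leP (- (x / 2)) pi.
  rewrite ler_sqr ?nnegrE ?sin_le_id ?sin_ge0_pi ?xpi//; lra.
apply: (@le_trans _ _ 1); first by have := cos2Dsin2 (- (x / 2)); nra.
by have := @pi_ge2 R; nra.
Qed.

Lemma cos_le_mono (R : realType) (x y : R) :
  0 <= x -> x <= pi -> 0 <= y -> y <= pi -> (cos x <= cos y) = (y <= x).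
Proof.
by move=> x0 xpi y0 ypi; rewrite !leNgt ltr_cos// in_itv/= ?x0 ?y0.
Qed.

Lemma acos_le (R : realType) (x y : R) :
  -1 <= x <= 1 -> 0 <= y -> cos y <= x -> acos x <= y.
Proof.
move=> x1 y0 yx; have [ypi|/ltW ypi] := leP y pi; last exact: le_trans (acos_lepi x1) _.
have [/andP[a0 api] aE] := acos_def x1.
by rewrite -cos_le_mono// aE.
Qed.

(** The difference vanishes at 0 and has derivative [l * (cos y - cos (l * y))], nonnegative because
    cosine decreases on the range considered. *)
Lemma sin_mul_le (R : realType) (l x : R) :
  1 <= l -> 0 <= x -> l * x <= pi / 2 -> sin (l * x) <= l * sin x.
Proof.
move=> l1 x0 lx.
pose f (y : R) := l * sin y - sin (l * y).
pose f' (y : R) := l * cos y - l * cos (l * y).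
have df (y : R) : is_derive y 1 f (f' y).
  rewrite /f /f'.
  apply: is_derive_eq.
  rewrite /GRing.scale /=; ring.
have cf : continuous f.
  by move=> y; apply/differentiable_continuous/derivable1_diffP; case: (df y).
have [c cI fE] := @MVT_segment R f f' 0 x x0 (fun y _ => df y) (continuous_subspaceT cf).
move: cI; rewrite in_itv/= => /andP[c0 cx].
have f0 : f 0 = 0 by rewrite /f mulr0 !sin0 mulr0 subr0.
have l0 : 0 <= l by rewrite (le_trans _ l1).
suff : 0 <= f x by rewrite /f subr_ge0.
have -> : f x = f' c * x by move: fE; rewrite f0 !subr0.
rewrite mulr_ge0// /f' -mulrBr mulr_ge0// subr_ge0.
have lc : l * c <= pi / 2 by rewrite (le_trans _ lx)// ler_wpM2l.
have pi0 := @pi_gt0 R.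
have lcc : c <= l * c by rewrite ler_peMl.
by rewrite cos_le_mono//; lra.
Qed.

Section dot_product.
Variable R : realType.
Implicit Types a b c : pt R.

Lemma dotC a b : dot a b = dot b a.
Proof. by rewrite /dot; ring. Qed.

Lemma sqr_dot_le a b : dot a b ^+ 2 <= dot a a * dot b b.
Proof.
case: a b => [[a1 a2] a3] [[b1 b2] b3]; rewrite /dot/px/py/pz/= -subr_ge0.
rewrite (_ : _ - _ = (a1*b2-a2*b1)^+2+(a1*b3-a3*b1)^+2+(a2*b3-a3*b2)^+2); last by ring.
by rewrite !addr_ge0 ?sqr_ge0.
Qed.

Lemma dot_bound a b : S2 a -> S2 b -> -1 <= dot a b <= 1.
Proof.
move=> a1 b1; have := sqr_dot_le a b; rewrite a1 b1 mulr1.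
by move=> h; apply/andP; split; nra.
Qed.

Lemma sigma_ge0 a b : S2 a -> S2 b -> 0 <= sigma a b.
Proof. by move=> ? ?; apply/acos_ge0/dot_bound. Qed.

Lemma sigma_le_pi a b : S2 a -> S2 b -> sigma a b <= pi.
Proof. by move=> ? ?; apply/acos_lepi/dot_bound. Qed.

Lemma cos_sigma a b : S2 a -> S2 b -> cos (sigma a b) = dot a b.
Proof. by move=> ? ?; apply: acosK; rewrite in_itv/= dot_bound. Qed.

Lemma sigmaC a b : sigma a b = sigma b a.
Proof. by rewrite /sigma dotC. Qed.

Lemma sigma_refl a : S2 a -> sigma a a = 0.
Proof. by rewrite /sigma => ->; rewrite acos1. Qed.

Lemma sin_sigma_ge0 a b : S2 a -> S2 b -> 0 <= sin (sigma a b).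
Proof. by move=> ? ?; rewrite sin_ge0_pi// sigma_ge0 ?sigma_le_pi. Qed.

Lemma sqr_sin_sigma a b : S2 a -> S2 b -> sin (sigma a b) ^+ 2 = 1 - dot a b ^+ 2.
Proof. by move=> ? ?; rewrite sin2cos2 cos_sigma. Qed.

(* The Gram determinant of three vectors is the square of their determinant. *)
Lemma sigma_triangle b a c : S2 a -> S2 b -> S2 c ->
  sigma a c <= sigma a b + sigma b c.
Proof.
move=> a1 b1 c1; apply: acos_le; first exact: dot_bound.
  by rewrite addr_ge0 ?sigma_ge0.
rewrite cosD !cos_sigma//.
set s := sin _; set t := sin _.
have s0 : 0 <= s by exact: sin_sigma_ge0.
have t0 : 0 <= t by exact: sin_sigma_ge0.
have s2 : s ^+ 2 = 1 - dot a b ^+ 2 by exact: sqr_sin_sigma.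
have t2 : t ^+ 2 = 1 - dot b c ^+ 2 by exact: sqr_sin_sigma.
have gram : (dot a b * dot b c - dot a c) ^+ 2 <= (s * t) ^+ 2.
  rewrite exprMn s2 t2 -subr_ge0.
  rewrite (_ : _ - _ = dot a a * (dot b b * dot c c - dot b c ^+ 2) -
     dot a b * (dot a b * dot c c - dot b c * dot a c) +
     dot a c * (dot a b * dot b c - dot b b * dot a c)); last first.
    by rewrite a1 b1 c1; ring.
  clear; case: a b c => [[a1 a2] a3] [[b1 b2] b3] [[c1 c2] c3].
  rewrite /dot/px/py/pz/=.
  rewrite (_ : _ + _ = (a1*(b2*c3-b3*c2) - a2*(b1*c3-b3*c1) + a3*(b1*c2-b2*c1))^+2).
    exact: sqr_ge0.
  ring.
have st0 : 0 <= s * t by exact: mulr_ge0.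
rewrite lerBlDr -lerBlDl.
have [|/ltW h] := leP (dot a b * dot b c - dot a c) 0.
  by move=> /le_trans; exact.
by rewrite ler_sqr ?nnegrE in gram.
Qed.

Definition chord2 a b : R := (px a - px b) ^+ 2 + (py a - py b) ^+ 2 + (pz a - pz b) ^+ 2.

Lemma chord2_dot a b : S2 a -> S2 b -> chord2 a b = 2 * (1 - dot a b).
Proof.
move=> a1 b1; rewrite (_ : chord2 a b = dot a a + dot b b - 2 * dot a b).
  by rewrite a1 b1; ring.
by rewrite /chord2/dot; ring.
Qed.

Lemma chord2_sigma a b : S2 a -> S2 b ->
  chord2 a b = 4 * sin (sigma a b / 2) ^+ 2.
Proof.
move=> a1 b1; rewrite chord2_dot// -cos_sigma//.
rewrite {1}(_ : sigma a b = (sigma a b / 2) *+ 2); last by rewrite -mulr_natr divfK.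
by rewrite cos_mulr2n cos2sin2; ring.
Qed.

Lemma chord2_le a b : S2 a -> S2 b -> chord2 a b <= sigma a b ^+ 2.
Proof.
move=> a1 b1; rewrite chord2_dot// -cos_sigma//.
by have := cos_ge_1B (sigma a b); lra.
Qed.

End dot_product.

(** * Finite covers and the upper bound for discs *)

(* [fincov near delta A c]: [A] has a finite cover by sets of diameter at most
   [delta] whose squared diameters add up to at most [c]; here [near e x y]
   stands for "the distance from [x] to [y] is at most [e]". *)
Inductive fincov {R : realType} {T : Type} (near : R -> T -> T -> Prop)
    (delta : R) : set T -> R -> Prop :=
| fincov_single A e : 0 <= e <= delta ->
    (forall x y, A x -> A y -> near e x y) -> fincov near delta A (e ^+ 2)
| fincov_union A B C a b c : fincov near delta A a -> fincov near delta B b ->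
    C `<=` A `|` B -> a + b <= c -> fincov near delta C c.

Section fincov_theory.
Context {R : realType} {T : Type} (near : R -> T -> T -> Prop) (delta : R).
Hypothesis delta0 : 0 <= delta.

Lemma fincov_ge0 A c : fincov near delta A c -> 0 <= c.
Proof. by elim=> *; [exact: sqr_ge0|lra]. Qed.

Lemma fincov0 : fincov near delta set0 0.
Proof. have := @fincov_single _ _ near delta set0 0; rewrite expr0n/=; apply=> //.
by rewrite lexx.
Qed.

Lemma fincovS A B a b : A `<=` B -> b <= a -> fincov near delta B b ->
  fincov near delta A a.
Proof.
by move=> AB ba; move/(fincov_union)/(_ fincov0); apply; rewrite ?setU0// addr0.
Qed.

Lemma fincov_bigcup n (A : nat -> set T) (c : nat -> R) :
  (forall i, (i < n)%N -> fincov near delta (A i) (c i)) ->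
  fincov near delta (\bigcup_(i < n) A i) (\sum_(i < n) c i).
Proof.
elim: n => [|n IHn] h; first by rewrite big_ord0 bigcup_mkord big_ord0; exact: fincov0.
rewrite big_ord_recr/=; apply: fincov_union (IHn _) (h n _) _ (lexx _) => //.
  by move=> i /ltnW; exact: h.
by rewrite !bigcup_mkord big_ord_recr.
Qed.

(** Flattens the tree of unions into a list. Reading it with the default [(set0, 0)] pads it to an
    infinite sequence of sets, the form required by [hausdorff2_delta], at no cost. *)
Lemma fincov_seq A c : fincov near delta A c -> exists s : seq (set T * R),
  [/\ forall x, A x -> exists i, (nth (set0, 0) s i).1 x,
      forall i, 0 <= (nth (set0, 0) s i).2 <= delta /\
        forall x y, (nth (set0, 0) s i).1 x -> (nth (set0, 0) s i).1 y ->
          near (nth (set0, 0) s i).2 x y &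
      forall n, \sum_(i < n) (nth (set0, 0) s i).2 ^+ 2 <= c].
Proof.
elim=> [{}A e e0 Ae|{c}A' B C a b c _ [s [s1 s2 s3]] _ [t [t1 t2 t3]] CAB abc].
  exists [:: (A, e)]; split.
  - by move=> x Ax; exists 0%N.
  - by case=> [|[|i]]//=; rewrite lexx delta0.
  - case=> [|n]; first by rewrite big_ord0 sqr_ge0.
    by rewrite big_ord_recl/= big1 ?addr0// => i _; rewrite nth_nil/= expr0n.
exists (s ++ t); split.
- move=> x /CAB[/s1[i ix]|/t1[i ix]].
    exists i; rewrite nth_cat; case: ltnP => // si.
    by rewrite nth_default in ix.
  exists (size s + i)%N; rewrite nth_cat ltnNge leq_addr/= addKn//.
- by move=> i; rewrite nth_cat; case: ifP.
move=> n; apply: le_trans abc; apply: (le_trans _ (lerD (s3 n) (t3 n))).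
have [ns|sn] := leqP n (size s).
  apply: (@le_trans _ _ (\sum_(i < n) (nth (set0, 0) s i).2 ^+ 2)); last first.
    by rewrite lerDl sumr_ge0// => *; exact: sqr_ge0.
  by apply: ler_sum => i _; rewrite nth_cat (leq_trans (ltn_ord i)).
rewrite -(subnKC (ltnW sn)) big_split_ord/=.
apply: lerD.
  rewrite [leRHS]big_split_ord/=.
  rewrite (_ : \sum_(i < size s) _ = \sum_(i < size s) (nth (set0, 0) s i).2 ^+ 2).
    by rewrite lerDl sumr_ge0// => *; exact: sqr_ge0.
  by apply: eq_bigr => i _; rewrite nth_cat ltn_ord.
rewrite [in leRHS]addnC big_split_ord/=.
rewrite (_ : \sum_(i < n - size s) _ = \sum_(i < n - size s) (nth (set0, 0) t i).2 ^+ 2).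
  by rewrite lerDl sumr_ge0// => *; exact: sqr_ge0.
by apply: eq_bigr => i _; rewrite nth_cat ltnNge leq_addr/= addKn.
Qed.

End fincov_theory.

(** Covers are transported backwards: it is enough that [chi] contracts distances on [X] at most by
    the factor [l]. *)
Lemma fincov_preimage {R : realType} {T T' : Type} (near : R -> T -> T -> Prop)
    (near' : R -> T' -> T' -> Prop) (X : set T) (chi : T -> T') (l delta : R) A c :
  0 <= l ->
  (forall e x y, 0 <= e -> X x -> X y -> near' e (chi x) (chi y) -> near (l * e) x y) ->
  fincov near' delta A c ->
  fincov near (l * delta) (X `&` chi @^-1` A) (l ^+ 2 * c).
Proof.
move=> l0 h; elim=> [{}A e /andP[e0 ed] Ae|{c}A' B C a b c _ IHA _ IHB CAB abc].
  rewrite -exprMn; apply: fincov_single; first by rewrite mulr_ge0//= ler_wpM2l.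
  by move=> x y [Xx Ax] [Xy Ay]; apply: h => //; exact: Ae.
apply: fincov_union IHA IHB _ _; last by rewrite -mulrDr ler_wpM2l ?sqr_ge0.
by move=> x [Xx /CAB[?|?]]; [left|right].
Qed.

Lemma fincov_hausdorff2_delta {R : realType} {T : Type} (d : T -> T -> \bar R)
    (delta : R) (A : set T) (c : R) : 0 <= delta ->
  fincov (fun e x y => (d x y <= e%:E)%E) delta A c ->
  (hausdorff2_delta d delta A <= (pi / 4 * c)%:E)%E.
Proof.
move=> delta0 /(fincov_seq delta0)[s [s1 s2 s3]].
have p4 : 0 <= pi / 4 :> R by rewrite divr_ge0 ?pi_ge0.
set U := fun i => (nth (set0, 0) s i).1.
have Ue i : (0 <= ediam d (U i) <= (nth (set0, 0) s i).2%:E)%E.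
  have [/andP[e0 ed] h] := s2 i; apply/andP; split.
    by apply: ereal_sup_ubound; right.
  apply: ge_ereal_sup => x [[y Uy [z Uz <-]]|->]; first exact: h.
  by rewrite lee_fin.
apply: (@le_trans _ _ (\sum_(i <oo) (pi / 4 * fine (ediam d (U i)) ^+ 2)%:E)%E).
  apply: ereal_inf_lbound; exists U => //; split.
    by move=> x /s1[i ix]; exists i.
  move=> i; have /andP[_ h] := Ue i; apply: (le_trans h).
  by rewrite lee_fin; have [/andP[]] := s2 i.
apply: lime_le.
  by apply: is_cvg_nneseries => n _ _; rewrite lee_fin mulr_ge0 ?sqr_ge0.
apply: nearW => n; rewrite big_mkord sumEFin lee_fin -mulr_sumr ler_wpM2l//.
apply: le_trans (s3 n); apply: ler_sum => i _.
have /andP[h0 h1] := Ue i.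
have fn : (ediam d (U i) \is a fin_num)%E.
  by apply: fin_real; rewrite (lt_le_trans _ h0)//= (le_lt_trans h1)// ltry.
rewrite ler_sqr ?nnegrE ?fine_ge0//; last by have [/andP[]] := s2 i.
by rewrite -lee_fin fineK.
Qed.

(** * Covering costs of squares, rectangles and discs *)

Section plane.
Context {R : realType}.
Implicit Types (c delta eps : R) (N : nat).

Definition eucl2 (p q : R * R) : R := (p.1 - q.1) ^+ 2 + (p.2 - q.2) ^+ 2.

Definition enear (e : R) (p q : R * R) : Prop := eucl2 p q <= e ^+ 2.

Definition rect (x0 y0 w h : R) : set (R * R) :=
  [set p | x0 <= p.1 <= x0 + w /\ y0 <= p.2 <= y0 + h].

(** Ordinate of the unit quarter circle above [k / N]; [upsum] and [losum] are the upper and lower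
    Riemann sums of its area. *)
Definition qcirc N (k : nat) : R := Num.sqrt (1 - (k%:R / N%:R) ^+ 2).

Definition upsum N : R := \sum_(k < N) qcirc N k / N%:R.
Definition losum N : R := \sum_(k < N) qcirc N k.+1 / N%:R.

Lemma qcirc_ge0 N k : 0 <= qcirc N k. Proof. exact: sqrtr_ge0. Qed.

Lemma qcirc_le1 N k : qcirc N k <= 1.
Proof. by rewrite -[leRHS]sqrtr1 ler_wsqrtr// gerBl sqr_ge0. Qed.

Lemma upsumB N : (0 < N)%N -> upsum N - losum N = N%:R^-1.
Proof.
move=> N0; rewrite /upsum /losum -sumrB.
under eq_bigr do rewrite -mulrBl -opprB mulNr.
rewrite sumrN -mulr_suml.
rewrite -(big_mkord xpredT (fun k => qcirc N k.+1 - qcirc N k)) telescope_sumr//.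
rewrite /qcirc divff ?pnatr_eq0 -?lt0n//.
by rewrite mul0r expr1n subrr sqrtr0 expr0n subr0 sqrtr1; ring.
Qed.

Lemma losum_ge0 N : 0 <= losum N.
Proof. by apply: sumr_ge0 => i _; rewrite divr_ge0 ?qcirc_ge0. Qed.

Lemma losum_le1 N : losum N <= 1.
Proof.
case: N => [|N]; first by rewrite /losum big_ord0.
apply: (@le_trans _ _ (\sum_(k < N.+1) N.+1%:R^-1)).
  by apply: ler_sum => i _; rewrite ler_piMl ?invr_ge0// qcirc_le1.
by rewrite sumr_const card_ord -[_ *+ _]mulr_natl divff ?pnatr_eq0.
Qed.

(** The quarter circle lies above its chord [1 - t]. A bound away from 0 turns the small difference
    in [upsumB] into a ratio close to 1. *)
Lemma upsum_ge N : (0 < N)%N -> 1 / 2 <= upsum N.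
Proof.
move=> N0; have N0' : (0 : R) < N%:R by rewrite ltr0n.
apply: (@le_trans _ _ (\sum_(k < N) (1 - k%:R / N%:R) / N%:R)); last first.
  apply: ler_sum => k _; rewrite ler_wpM2r ?invr_ge0 ?ler0n//.
  have k1 : 0 <= (k%:R / N%:R : R) <= 1.
    by rewrite divr_ge0//= ler_pdivrMr// mul1r ler_nat ltnW.
  rewrite /qcirc; move: k1; set t := _ / _ => /andP[t0 t1].
  rewrite -[leLHS]ger0_norm ?subr_ge0// -sqrtr_sqr ler_wsqrtr//; nra.
suff: forall n, (\sum_(k < n) (1 - k%:R / N%:R)) = n%:R - n%:R * (n%:R - 1) / 2 / N%:R :> R.
  rewrite -mulr_suml => ->.
  rewrite (_ : _ / N%:R = 1 / 2 + (2 * N%:R)^-1); last by field; rewrite gt_eqF.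
  by rewrite lerDl invr_ge0 mulr_ge0// ltW.
elim=> [|n IHn]; first by rewrite big_ord0; ring.
by rewrite big_ord_recr/= IHn -natr1; field; rewrite gt_eqF.
Qed.

Lemma fincov_grid (delta x0 y0 s w h c : R) (K J : nat) :
  0 <= delta -> 0 < s ->
  (forall x y, fincov enear delta (rect x y s s) c) ->
  w <= K.+1%:R * s -> h <= J.+1%:R * s ->
  fincov enear delta (rect x0 y0 w h) (K.+1%:R * J.+1%:R * c).
Proof.
move=> d0 s0 hc wK hJ.
pose A (i j : nat) := rect (x0 + i%:R * s) (y0 + j%:R * s) s s.
have := @fincov_bigcup _ _ enear delta d0 K.+1 (fun i => \bigcup_(j < J.+1) A i j)
   (fun i => \sum_(j < J.+1) c).
move=> /(_ (fun i _ => @fincov_bigcup _ _ enear delta d0 J.+1 _ (fun=> c) (fun j _ => hc _ _))).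
rewrite !sumr_const !card_ord -mulrnA => H.
rewrite -natrM mulr_natl mulnC.
apply: fincovS H => //.
have KS (n : nat) : n.+1%:R * s = n%:R * s + s by rewrite -natr1 mulrDl mul1r.
have idx (t : R) (w' : R) (K' : nat) : 0 <= t <= w' -> w' <= K'.+1%:R * s ->
    exists2 i, (i < K'.+1)%N & i%:R * s <= t <= i%:R * s + s.
  move=> /andP[t0 tw] wK'; pose i := Num.truncn (t / s).
  have ts : 0 <= t / s by rewrite divr_ge0// ltW.
  have /andP[i1 i2] := truncn_itv ts.
  have [iK|Ki] := ltnP i K'.+1.
    exists i => //; apply/andP; split; first by rewrite -ler_pdivlMr.
    by rewrite -KS -ler_pdivrMr// ltW.
  (* Only the right end [t = K'.+1 * s] gets here; it belongs to the last closed cell. *)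
  exists K' => //.
  have : K'.+1%:R * s <= t.
    by rewrite -ler_pdivlMr// (le_trans _ i1)// ler_nat.
  by rewrite KS => ?; apply/andP; split; lra.
move=> [x y] [/= /andP[x1 x2] /andP[y1 y2]].
have [|i iK /andP[i1 i2]] := idx (x - x0) w K _ wK; first by apply/andP; split; lra.
have [|j jJ /andP[j1 j2]] := idx (y - y0) h J _ hJ; first by apply/andP; split; lra.
exists i => //; exists j => //; split => /=; apply/andP; split; lra.
Qed.

(** An admissible cost per unit area. It must serve every mesh [delta] and every side, so that it
    can be used again inside smaller pieces. *)
Definition square_cost c : Prop := forall delta s x0 y0 : R, 0 < delta -> 0 < s ->
  fincov enear delta (rect x0 y0 s s) (c * s ^+ 2).

Lemma square_cost_ge0 c : square_cost c -> 0 <= c.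
Proof.
by move=> h; have := fincov_ge0 (h 1 1 0 0 ltr01 ltr01); rewrite expr1n mulr1.
Qed.

Lemma square_cost_le c c' : c <= c' -> square_cost c -> square_cost c'.
Proof.
move=> cc' h delta s x0 y0 d0 s0; apply: (fincovS (ltW d0) (@subset_refl _ _) _ (h _ _ _ _ d0 s0)).
by rewrite ler_wpM2r ?sqr_ge0.
Qed.

Lemma square_cost_small c : (forall delta s x0 y0 : R, 0 < delta -> 0 < s ->
   2 * s <= delta -> fincov enear delta (rect x0 y0 s s) (c * s ^+ 2)) -> square_cost c.
Proof.
move=> h delta s x0 y0 d0 s0.
have d20 : 0 < delta / 2 by lra.
pose M := Num.truncn (s / (delta / 2)).
have sM : s / (delta / 2) <= M.+1%:R.
  by have /andP[_ /ltW] := truncn_itv (divr_ge0 (ltW s0) (ltW d20)).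
have M0 : (0 : R) < M.+1%:R by rewrite ltr0n.
have sM0 : 0 < s / M.+1%:R by rewrite divr_gt0.
have sE : s = M.+1%:R * (s / M.+1%:R) by field; rewrite gt_eqF.
rewrite (_ : c * s ^+ 2 = M.+1%:R * M.+1%:R * (c * (s / M.+1%:R) ^+ 2)); last first.
  by field; rewrite gt_eqF.
apply: (fincov_grid _ _ _ sM0); rewrite -?sE//; first exact: ltW.
move=> x y; apply: (h _ _ _ _ d0 sM0).
have : s / M.+1%:R <= delta / 2 by rewrite ler_pdivrMr// mulrC -ler_pdivrMr.
by clear sE sM sM0; move: (s / M.+1%:R) => u; lra.
Qed.

Lemma square_cost2 : square_cost 2.
Proof.
have s2 : 0 <= Num.sqrt 2 :> R by exact: sqrtr_ge0.
have s2s : Num.sqrt 2 ^+ 2 = 2 :> R by rewrite sqr_sqrtr.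
have s22 : Num.sqrt 2 <= 2 :> R by nra.
apply: square_cost_small => delta t x y d0 t0 td.
rewrite -s2s -exprMn; apply: fincov_single.
  by rewrite mulr_ge0 ?ltW//=; nra.
move=> [a b] [a' b'] [/= /andP[a1 a2] /andP[b1 b2]] [/= /andP[a3 a4] /andP[b3 b4]].
rewrite /enear /eucl2/= exprMn s2s.
have : (a - a') ^+ 2 <= t ^+ 2 by nra.
have : (b - b') ^+ 2 <= t ^+ 2 by nra.
lra.
Qed.

End plane.

Section plane2.
Context {R : realType}.
Implicit Types (c delta eps : R) (N : nat).

Lemma fincov_rect c delta eps (x0 y0 w h : R) : square_cost c ->
  0 < delta -> 0 < eps -> 0 <= w -> 0 <= h ->
  fincov enear delta (rect x0 y0 w h) (c * w * h + eps).
Proof.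
move=> Hc d0 e0 w0 h0; have c0 := square_cost_ge0 Hc.
have X0 : 0 <= c * (w + h + 1) by rewrite mulr_ge0//; lra.
(* A grid of mesh [s] overshoots each side by at most [s], hence the area by at most
   [s * (w + h + 1)]. The last [+ 1] keeps the denominator positive when [c = 0]. *)
pose s := Num.min 1 (eps / (c * (w + h + 1) + 1)).
have s0 : 0 < s by rewrite lt_min ltr01/= divr_gt0//; lra.
have s1 : s <= 1 by rewrite ge_min lexx.
have sX : s * (c * (w + h + 1) + 1) <= eps.
  rewrite -ler_pdivlMr; last by lra.
  by rewrite ge_min lexx orbT.
have KS (n : nat) : n.+1%:R * s = n%:R * s + s by rewrite -natr1 mulrDl mul1r.
have cnt t : 0 <= t -> exists K : nat, t <= K.+1%:R * s <= t + s.
  move=> t0; exists (Num.truncn (t / s)).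
  have /andP[i1 /ltW i2] := truncn_itv (divr_ge0 t0 (ltW s0)).
  rewrite -ler_pdivrMr// i2/= KS.
  by move: i1; rewrite ler_pdivlMr//; set u := _ * s; lra.
have [K /andP[K1 K2]] := cnt w w0.
have [J /andP[J1 J2]] := cnt h h0.
have H := fincov_grid x0 y0 (ltW d0) s0 (fun x y => Hc delta s x y d0 s0) K1 J1.
apply: (fincovS (ltW d0) (@subset_refl _ _) _ H).
move: K1 K2 J1 J2; rewrite (_ : K.+1%:R * _ * _ = c * ((K.+1%:R * s) * (J.+1%:R * s))); last by ring.
move: (_ * s) => a; move: (_ * s) => b a1 a2 b1 b2.
apply: (@le_trans _ _ (c * ((w + s) * (h + s)))).
  by rewrite ler_wpM2l// ler_pM//; lra.
have : c * s * s <= c * s * 1 by rewrite ler_wpM2l// mulr_ge0// ltW.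
nra.
Qed.

Lemma column_index N (h u : R) : 0 < h -> (0 < N)%N -> 0 <= u -> u <= h ->
  exists2 k, (k < N)%N & k%:R * (h / N%:R) <= u <= k.+1%:R * (h / N%:R).
Proof.
move=> h0 N0 u0 uh; have N0' : (0 : R) < N%:R by rewrite ltr0n.
have hN : 0 < h / N%:R by rewrite divr_gt0.
have /andP[i1 i2] := truncn_itv (divr_ge0 u0 (ltW hN)).
have [kN|Nk] := ltnP (Num.truncn (u / (h / N%:R))) N.
  exists (Num.truncn (u / (h / N%:R))) => //.
  by rewrite -ler_pdivlMr// i1/= -ler_pdivrMr// ltW.
exists N.-1; rewrite prednK//.
rewrite (_ : N%:R * (h / N%:R) = h); last by field; rewrite gt_eqF.
rewrite uh andbT (@le_trans _ _ (N%:R * (h / N%:R)))//.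
  by rewrite ler_wpM2r ?(ltW hN)// ler_nat leq_pred.
by rewrite -ler_pdivlMr// (le_trans _ i1)// ler_nat.
Qed.

(* In each small square, inscribe a disc, which costs the squared side, and
   cover the corners by columns, of total relative area [1 - losum N]. *)
Lemma square_cost_step c eps N : (0 < N)%N -> 0 < eps -> square_cost c ->
  square_cost (1 + (1 - losum N) * c + eps).
Proof.
move=> N0 e0 Hc; have c0 := square_cost_ge0 Hc.
have N0' : (0 : R) < N%:R by rewrite ltr0n.
apply: square_cost_small => delta t x0 y0 d0 t0 td.
have [h hE] : exists h, h = t / 2 by exists (t / 2).
have h0 : 0 < h by rewrite hE; lra.
pose q k : R := qcirc N k.
pose cx := x0 + h; pose cy := y0 + h.
pose disc : set (R * R) := [set p | eucl2 p (cx, cy) <= h ^+ 2].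
have Hd : fincov enear delta disc (t ^+ 2).
  apply: fincov_single; first by apply/andP; split; lra.
  move=> [a b] [a' b']; rewrite /disc/enear/eucl2/= => d1 d2.
  (* Parallelogram identity about the centre of the disc. *)
  have -> : (a - a') ^+ 2 + (b - b') ^+ 2 =
     2 * ((a - cx) ^+ 2 + (b - cy) ^+ 2) + 2 * ((a' - cx) ^+ 2 + (b' - cy) ^+ 2)
     - ((a - cx + (a' - cx)) ^+ 2 + (b - cy + (b' - cy)) ^+ 2) by ring.
  have -> : t ^+ 2 = 2 * h ^+ 2 + 2 * h ^+ 2 by rewrite hE; field.
  have := sqr_ge0 (a - cx + (a' - cx)); have := sqr_ge0 (b - cy + (b' - cy)).
  lra.
(* An equal share of the error for each of the [4 * N] columns, [N] in each corner. *)
pose e1 := eps * t ^+ 2 / (4 * N%:R).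
have e10 : 0 < e1 by rewrite /e1 divr_gt0 ?mulr_gt0 ?exprn_gt0.
pose qx (b : bool) (k : nat) := if b then cx + k%:R * (h / N%:R) else cx - k.+1%:R * (h / N%:R).
pose qy (b : bool) (k : nat) := if b then cy + h * q k.+1 else cy - h.
pose Q b b' k := rect (qx b k) (qy b' k) (h / N%:R) (h * (1 - q k.+1)).
have HQ b b' k : fincov enear delta (Q b b' k) (c * (h / N%:R) * (h * (1 - q k.+1)) + e1).
  apply: fincov_rect => //.
    by rewrite divr_ge0// ltW.
  by rewrite mulr_ge0 ?(ltW h0)// subr_ge0 qcirc_le1.
have HQb b b' := @fincov_bigcup _ _ enear delta (ltW d0) N (Q b b') _ (fun k _ => HQ b b' k).
set S := \sum_(k < N) _ in HQb.
have SE : S = (c * t ^+ 2 * (1 - losum N) + eps * t ^+ 2) / 4.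
  rewrite /S big_split/= sumr_const card_ord -(mulr_natl e1) /e1 /losum.
  have E (k : nat) : c * (h / N%:R) * (h * (1 - qcirc N k.+1)) =
      (c * h ^+ 2) * (N%:R^-1 - qcirc N k.+1 / N%:R).
    by field; rewrite gt_eqF.
  rewrite (eq_bigr _ (fun k _ => E (nat_of_ord k))).
  rewrite -mulr_sumr sumrB sumr_const card_ord -(mulr_natl N%:R^-1) divff ?gt_eqF//.
  by rewrite hE; field; rewrite gt_eqF.
have HU := fincov_union Hd (fincov_union (fincov_union (HQb true true) (HQb true false) (@subset_refl _ _) (lexx _))
  (fincov_union (HQb false true) (HQb false false) (@subset_refl _ _) (lexx _)) (@subset_refl _ _) (lexx _))
  (@subset_refl _ _) (lexx _).
apply: (fincovS (ltW d0) _ _ HU); last by rewrite SE; lra.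
move=> [x y] [/= /andP[x1 x2] /andP[y1 y2]].
have [din|dout] := leP (eucl2 (x, y) (cx, cy)) (h ^+ 2); first by left.
right.
(* Outside the disc, a point of column [k] lies above the circle at its own abscissa, hence above
   the lower ordinate at the outer edge [k.+1]. *)
have col (u v : R) : 0 <= u <= h -> 0 <= v <= h -> h ^+ 2 < u ^+ 2 + v ^+ 2 ->
   exists k, [/\ (k < N)%N, k%:R * (h / N%:R) <= u <= k.+1%:R * (h / N%:R) &
                  h * q k.+1 <= v].
  move=> /andP[u0 uh] /andP[v0 vh] uv.
  have [k kN ku] := column_index h0 N0 u0 uh.
  exists k; split => //.
  have -> : v = h * (v / h) by field; rewrite gt_eqF.
  rewrite ler_wpM2l ?(ltW h0)//.
  have vh0 : 0 <= v / h by rewrite divr_ge0// ltW.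
  rewrite -(ger0_norm vh0) -sqrtr_sqr ler_wsqrtr//.
  have uk : u / h <= k.+1%:R / N%:R.
    move: ku => /andP[_].
    rewrite ler_pdivrMr// => /le_trans; apply.
    by rewrite mulrA -mulrAC.
  have uh0 : 0 <= u / h by rewrite divr_ge0// ltW.
  have : (u / h) ^+ 2 <= (k.+1%:R / N%:R) ^+ 2 by rewrite ler_sqr ?nnegrE ?(le_trans uh0).
  have : 1 < (u / h) ^+ 2 + (v / h) ^+ 2.
    by rewrite !expr_div_n -mulrDl ltr_pdivlMr ?exprn_gt0// mul1r.
  move: (_ / N%:R) => z; lra.
have hN : 0 <= h / N%:R by rewrite divr_ge0// ltW.
have KS (n : nat) : n.+1%:R * (h / N%:R) = n%:R * (h / N%:R) + h / N%:R.
  by rewrite -natr1 mulrDl mul1r.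
have [k [kN ku kv]] : exists k, [/\ (k < N)%N,
    k%:R * (h / N%:R) <= `|x - cx| <= k.+1%:R * (h / N%:R) &
    h * q k.+1 <= `|y - cy| ].
  apply: col.
  - by rewrite normr_ge0/= ler_norml /cx; move: hE x1 x2 => *; apply/andP; split; lra.
  - by rewrite normr_ge0/= ler_norml /cy; move: hE y1 y2 => *; apply/andP; split; lra.
  - by rewrite !real_normK ?num_real.
have yh : `|y - cy| <= h by rewrite ler_norml /cy; move: hE y1 y2 => *; apply/andP; split; lra.
have HQk : Q (cx <= x) (cy <= y) k (x, y).
  rewrite /Q/rect/qx/qy/=; move: ku kv yh; rewrite KS mulrBr mulr1.
  set A := h * q k.+1; set B := k%:R * (h / N%:R); set C := h / N%:R.
  clearbody A B C; clear.
  have [cx1|cx1] := leP cx x; have [cy1|cy1] := leP cy y.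
  - rewrite !ger0_norm ?subr_ge0// => /andP[? ?] ? ?; split; apply/andP; split; lra.
  - rewrite ger0_norm ?subr_ge0// ltr0_norm ?subr_lt0// => /andP[? ?] ? ?.
    split; apply/andP; split; lra.
  - rewrite ltr0_norm ?subr_lt0// ger0_norm ?subr_ge0// => /andP[? ?] ? ?.
    split; apply/andP; split; lra.
  - rewrite !ltr0_norm ?subr_lt0// => /andP[? ?] ? ?.
    split; apply/andP; split; lra.
case: (cx <= x) HQk; case: (cy <= y) => HQk.
- by left; left; exists k.
- by left; right; exists k.
- by right; left; exists k.
- by right; right; exists k.
Qed.

End plane2.

Section disc_cost.
Context {R : realType}.
Implicit Types (c delta eps : R) (N : nat).

(** Evaluating [square_cost_step] at the infimum of the admissible costs replaces an infinite
    iteration. The inequality is strict because the infimum is not shown to be attained. *)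
Lemma square_cost_losum c N : (0 < N)%N -> 1 < losum N * c -> square_cost c.
Proof.
move=> N0 Nc.
have l0 := @losum_ge0 R N; have l1 := @losum_le1 R N.
pose S : set R := [set c | square_cost c].
have Sinf : has_inf S.
  split; first by exists 2; exact: square_cost2.
  by exists 0 => x; exact: square_cost_ge0.
have lt_sq x : inf S < x -> square_cost x.
  by move=> /(inf_lt (proj1 Sinf))[y Sy /ltW yx]; exact: square_cost_le Sy.
apply: (lt_sq); set m := inf S.
have m_step eps : 0 < eps -> m <= 1 + (1 - losum N) * (m + eps) + eps.
  move=> e0; apply: ge_inf; first by have [] := Sinf.
  by apply: square_cost_step => //; apply: lt_sq; rewrite ltrDl.
have m1 : losum N * m <= 1.
  apply/ler_addgt0Pr => e e0.
  have e20 : 0 < e / 2 by lra.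
  by have := m_step _ e20; nra.
have lpos : 0 < losum N :> R.
  rewrite ltNge; apply/negP => ?; have E : losum N = 0 :> R by lra.
  by move: Nc; rewrite E mul0r; lra.
by rewrite -(ltr_pM2l lpos); lra.
Qed.

(** [4 * rho ^+ 2] is the squared diameter of the disc: arbitrarily fine covers cost hardly more
    than the disc taken as a single set. Each quadrant is covered by columns at the cost
    [eta * rho ^+ 2]. *)
Lemma fincov_disc (eta delta rho : R) : 1 < eta -> 0 < delta -> 0 < rho ->
  fincov enear delta [set p : R * R | p.1 ^+ 2 + p.2 ^+ 2 <= rho ^+ 2] (4 * eta * rho ^+ 2).
Proof.
move=> e1 d0 r0.
(* Large enough for [eta / N < (eta - 1) / 2 <= (eta - 1) * upsum N], which means
   [upsum N < eta * losum N]. *)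
pose N := (Num.truncn (2 * eta / (eta - 1))).+1.
have N0 : (0 < N)%N by [].
have N0' : (0 : R) < N%:R by rewrite ltr0n.
have NE : 2 * eta < (eta - 1) * N%:R.
  rewrite [ltRHS]mulrC -ltr_pdivrMr; last by lra.
  have h : 0 <= 2 * eta / (eta - 1) by apply: divr_ge0; lra.
  by have /andP[] := truncn_itv h.
clearbody N; have U2 := @upsum_ge R N N0; have UL := @upsumB R N N0.
set U := upsum N in U2 UL; set L := losum N in UL.
have NV : 0 < N%:R^-1 :> R by rewrite invr_gt0.
have etaN : eta * N%:R^-1 < (eta - 1) / 2.
  by rewrite ltr_pdivrMr//; lra.
have UeL : U < eta * L by nra.
have L0 : 0 < L by nra.
have U0 : 0 < U by lra.
have LU : L^-1 < eta / U.
  by rewrite ltr_pdivlMr// mulrC ltr_pdivrMr.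
(* Strictly between [L^-1], so that [c] is an admissible cost, and [eta / U], so that the columns
   keep a margin [e2]. *)
pose c := (L^-1 + eta / U) / 2.
have Lc : 1 < L * c.
  by rewrite mulrC -ltr_pdivrMr// mul1r /c; lra.
have cU : c * U < eta by rewrite -ltr_pdivlMr// /c; lra.
have Hc := square_cost_losum N0 Lc.
have c0 := square_cost_ge0 Hc.
pose e2 := (eta - c * U) * rho ^+ 2 / N%:R.
have e20 : 0 < e2 by rewrite divr_gt0// mulr_gt0 ?exprn_gt0// subr_gt0.
have rN : 0 <= rho / N%:R by rewrite divr_ge0// ltW.
pose qx (b : bool) (k : nat) : R := if b then k%:R * (rho / N%:R) else - (k.+1%:R * (rho / N%:R)).
pose qy (b : bool) (k : nat) : R := if b then 0 else - (rho * qcirc N k).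
pose Q b b' k := rect (qx b k) (qy b' k) (rho / N%:R) (rho * qcirc N k).
have HQ b b' k : fincov enear delta (Q b b' k) (c * (rho / N%:R) * (rho * qcirc N k) + e2).
  by apply: fincov_rect => //; rewrite mulr_ge0 ?qcirc_ge0// ltW.
have HQb b b' := @fincov_bigcup _ _ enear delta (ltW d0) N (Q b b') _ (fun k _ => HQ b b' k).
set S := \sum_(k < N) _ in HQb.
have SE : S = eta * rho ^+ 2.
  rewrite /S big_split/= sumr_const card_ord -(mulr_natl e2).
  rewrite (_ : \sum_(i < N) _ = c * rho ^+ 2 * U).
    by rewrite /e2; field; rewrite gt_eqF.
  rewrite /U /upsum mulr_sumr; apply: eq_bigr => k _.
  by field; rewrite gt_eqF.
have HU := (fincov_union (fincov_union (HQb true true) (HQb true false) (@subset_refl _ _) (lexx _))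
  (fincov_union (HQb false true) (HQb false false) (@subset_refl _ _) (lexx _)) (@subset_refl _ _) (lexx _)).
apply: (fincovS (ltW d0) _ _ HU); last by rewrite SE; lra.
move=> [x y] /= xy.
have xr : `|x| <= rho.
  rewrite -ler_sqr ?nnegrE ?normr_ge0 ?(ltW r0)// real_normK ?num_real//.
  by have := sqr_ge0 y; lra.
have [k kN /andP[k1 k2]] := column_index r0 N0 (normr_ge0 x) xr.
have yq : `|y| <= rho * qcirc N k.
  have -> : `|y| = rho * (`|y| / rho) by field; rewrite gt_eqF.
  rewrite ler_wpM2l ?(ltW r0)//.
  have yr0 : 0 <= `|y| / rho by rewrite divr_ge0// ltW.
  rewrite -(ger0_norm yr0) -sqrtr_sqr ler_wsqrtr//.
  have kx : k%:R / N%:R <= `|x| / rho.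
    by rewrite ler_pdivlMr// (le_trans _ k1)// mulrAC mulrA.
  have : (k%:R / N%:R) ^+ 2 <= (`|x| / rho) ^+ 2 by rewrite ler_sqr ?nnegrE ?divr_ge0// ltW.
  have : (`|x| / rho) ^+ 2 + (`|y| / rho) ^+ 2 <= 1.
    rewrite !expr_div_n -mulrDl !real_normK ?num_real// ler_pdivrMr ?exprn_gt0//.
    by rewrite mul1r.
  move: (_ / N%:R) => z; lra.
have KS (n : nat) : n.+1%:R * (rho / N%:R) = n%:R * (rho / N%:R) + rho / N%:R.
  by rewrite -natr1 mulrDl mul1r.
have HQk : Q (0 <= x) (0 <= y) k (x, y).
  rewrite /Q/rect/qx/qy/=; move: k1 k2 yq; rewrite KS.
  set A := rho * qcirc N k; set B := k%:R * (rho / N%:R); set C := rho / N%:R.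
  clearbody A B C; clear.
  have [cx1|cx1] := leP 0 x; have [cy1|cy1] := leP 0 y.
  - rewrite !ger0_norm// => ? ? ?; split; apply/andP; split; lra.
  - rewrite ger0_norm// ltr0_norm// => ? ? ?; split; apply/andP; split; lra.
  - rewrite ltr0_norm// ger0_norm// => ? ? ?; split; apply/andP; split; lra.
  - rewrite !ltr0_norm// => ? ? ?; split; apply/andP; split; lra.
case: (0 <= x) HQk; case: (0 <= y) => HQk.
- by left; left; exists k.
- by left; right; exists k.
- by right; left; exists k.
- by right; right; exists k.
Qed.

End disc_cost.

(** * Orthographic projection *)

Lemma sin_ge_cubic (R : realType) (x : R) : 0 <= x -> x * (1 - x ^+ 2 / 2) <= sin x.
Proof.
rewrite le_eqVlt => /orP[/eqP<-|x0]; first by rewrite sin0 mul0r.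
have [c cI] := @MVT_segment R sin cos 0 x (ltW x0) (fun y _ => is_derive_sin y)
  (continuous_subspaceT (@continuous_sin R)).
move: cI; rewrite in_itv/= => /andP[c0 cx].
rewrite sin0 !subr0 => ->; rewrite mulrC ler_wpM2r ?(ltW x0)//.
apply: le_trans (cos_ge_1B c).
have : c ^+ 2 <= x ^+ 2 by rewrite ler_sqr ?nnegrE// ltW.
lra.
Qed.

Section sphere_local.
Context {R : realType}.
Implicit Types (a b p : pt R) (k e : R).

(** The sharp comparison: at distances up to [1 - k], arc and chord agree up to the factor [k]. *)
Lemma sigma_le_chord k a b : 0 < k -> k < 1 -> S2 a -> S2 b -> sigma a b <= 1 - k ->
  k ^+ 2 * sigma a b ^+ 2 <= chord2 a b.
Proof.
move=> k0 k1 a1 b1 abk; rewrite chord2_sigma//.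
have s0 := sigma_ge0 a1 b1; set s := sigma a b in s0 abk *.
have s20 : 0 <= s / 2 by lra.
have h := sin_ge_cubic s20.
have k1s : k <= 1 - (s / 2) ^+ 2 / 2 by nra.
have : s / 2 * k <= sin (s / 2) by apply: le_trans h; rewrite ler_wpM2l.
have : 0 <= s / 2 * k by rewrite mulr_ge0// ltW.
nra.
Qed.

(** Jordan's inequality, valid at all scales but not sharp. It serves to bring two image points
    within the range of [sigma_le_chord]. *)
Lemma sigma_le_pihalf_chord a b : S2 a -> S2 b ->
  sigma a b ^+ 2 <= (pi / 2) ^+ 2 * chord2 a b.
Proof.
move=> a1 b1; rewrite chord2_sigma//.
have s0 := sigma_ge0 a1 b1; have s1 := sigma_le_pi a1 b1; set s := sigma a b in s0 s1 *.
have pi0 := @pi_gt0 R.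
have [->|sN0] := eqVneq s 0; first by rewrite mul0r sin0; nra.
have sp : 0 < s by rewrite lt_neqAle eq_sym sN0.
have l1 : 1 <= pi / s by rewrite ler_pdivlMr// mul1r.
have E : pi / s * (s / 2) = pi / 2 by field.
have := sin_mul_le l1 (divr_ge0 s0 (ler0n _ 2)); rewrite E lexx sin_pihalf => /(_ isT).
rewrite mulrAC ler_pdivlMr// mul1r.
have : 0 <= sin (s / 2) by rewrite sin_ge0_pi//; apply/andP; split; lra.
nra.
Qed.

(** Orthonormality is stated as Parseval's identity. Away from the south pole, [e1] and [e2] are the
    images of the first two basis vectors under the rotation taking the north pole to [p] along a
    meridian. *)
Lemma orthonormal_frame p : S2 p -> exists e1 e2 : pt R, forall v w,
  dot v w = dot p v * dot p w + dot e1 v * dot e1 w + dot e2 v * dot e2 w.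
Proof.
case: p => [[x y] z]; rewrite /S2/dot/px/py/pz/= => p1.
have [z1|z1] := eqVneq z (-1).
  exists (1, 0, 0), (0, 1, 0) => v w /=.
  have -> : x = 0 by nra.
  have -> : y = 0 by nra.
  rewrite z1; ring.
have z10 : 1 + z != 0 by rewrite addrC -[1]opprK subr_eq0.
exists (1 - x ^+ 2 / (1 + z), - (x * y) / (1 + z), - x),
  (- (x * y) / (1 + z), 1 - y ^+ 2 / (1 + z), - y) => v w /=.
set u := 1 + z in z10 *.
have s1 : x * x + y * y + z * z - 1 = 0 by rewrite p1 subrr.
apply/eqP; rewrite eq_sym -subr_eq0; apply/eqP.
rewrite (_ : _ - _ = (x * x + y * y + z * z - 1) *
   (x / u * v.1.1 + y / u * v.1.2 + v.2) * (x / u * w.1.1 + y / u * w.1.2 + w.2)).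
  by rewrite s1 !mul0r.
by rewrite /u; field.
Qed.

Definition frame_proj (e1 e2 a : pt R) : R * R := (dot e1 a, dot e2 a).

Section frame.
Variables p e1 e2 : pt R.
Hypothesis p1 : S2 p.
Hypothesis frame : forall v w,
  dot v w = dot p v * dot p w + dot e1 v * dot e1 w + dot e2 v * dot e2 w.

Lemma chord2_frame a b :
  chord2 a b = (dot p a - dot p b) ^+ 2 + eucl2 (frame_proj e1 e2 a) (frame_proj e1 e2 b).
Proof.
have -> : chord2 a b = dot a a + dot b b - 2 * dot a b by rewrite /chord2/dot; ring.
by rewrite (frame a a) (frame b b) (frame a b) /eucl2/=; ring.
Qed.

Lemma frame_proj_le a b : S2 a -> S2 b ->
  eucl2 (frame_proj e1 e2 a) (frame_proj e1 e2 b) <= sigma a b ^+ 2.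
Proof.
move=> a1 b1; apply: le_trans (chord2_le a1 b1).
by rewrite chord2_frame lerDr sqr_ge0.
Qed.

Lemma frame_proj_norm a : S2 a ->
  (frame_proj e1 e2 a).1 ^+ 2 + (frame_proj e1 e2 a).2 ^+ 2 <= sigma p a ^+ 2.
Proof.
move=> a1; have := frame_proj_le a1 p1; rewrite (sigmaC a).
rewrite (_ : eucl2 _ _ = (frame_proj e1 e2 a).1 ^+ 2 + (frame_proj e1 e2 a).2 ^+ 2)//.
have := frame p p; rewrite p1 mulr1 -addrA -[LHS]addr0 => /addrI/esym/eqP.
rewrite paddr_eq0 -?expr2 ?sqr_ge0// !expf_eq0/= => /andP[/eqP h1 /eqP h2].
by rewrite /eucl2/= h1 h2 !subr0.
Qed.

(** Near [p] the discarded coordinate [u = dot p a] satisfies [u ^+ 2 = 1 - |projection|^2], so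
    differences of [u] are small compared with differences of projections. One factor [k] pays for
    arc against chord, the other for chord against projection. *)
Lemma sigma_le_frame_proj k a b : 0 < k -> k < 1 -> S2 a -> S2 b ->
  sigma p a <= (1 - k) / 4 -> sigma p b <= (1 - k) / 4 ->
  (k ^+ 2 * sigma a b) ^+ 2 <= eucl2 (frame_proj e1 e2 a) (frame_proj e1 e2 b).
Proof.
move=> k0 k1 a1 b1 pa pb.
have ab : sigma a b <= 1 - k.
  by have := sigma_triangle a1 p1 b1; rewrite (sigmaC a p); lra.
have := sigma_le_chord k0 k1 a1 b1 ab; rewrite chord2_frame.
set E := eucl2 _ _.
have [pa0 pb0] := (sigma_ge0 p1 a1, sigma_ge0 p1 b1).
have cu : 1 - sigma p a ^+ 2 / 2 <= dot p a by rewrite -cos_sigma// cos_ge_1B.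
have cv : 1 - sigma p b ^+ 2 / 2 <= dot p b by rewrite -cos_sigma// cos_ge_1B.
have na := frame_proj_norm a1; have nb := frame_proj_norm b1.
have fa := frame a a; have fb := frame b b.
rewrite a1 in fa; rewrite b1 in fb.
have E0 : 0 <= E by rewrite addr_ge0 ?sqr_ge0.
move: na nb fa fb; rewrite /frame_proj/=.
set u := dot p a; set v := dot p b.
set a1' := dot e1 a; set a2 := dot e2 a; set b1' := dot e1 b; set b2 := dot e2 b => na nb fa fb.
set r := (1 - k) / 4 in pa pb.
have r0 : 0 < r by rewrite /r; lra.
have r4 : r < 1 / 4 by rewrite /r; lra.
have na2 : a1' ^+ 2 + a2 ^+ 2 <= r ^+ 2 by nra.
have nb2 : b1' ^+ 2 + b2 ^+ 2 <= r ^+ 2 by nra.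
rewrite -/u in cu; rewrite -/v in cv.
have u1 : 1 / 2 <= u by nra.
have v1 : 1 / 2 <= v by nra.
have key : (u - v) ^+ 2 <= 4 * r ^+ 2 * E.
  apply: (@le_trans _ _ (((u - v) * (u + v)) ^+ 2)).
    by rewrite exprMn ler_peMr ?sqr_ge0 ?exprn_ege1//; lra.
  have -> : (u - v) * (u + v) = (b1' - a1') * (b1' + a1') + (b2 - a2) * (b2 + a2).
    have -> : (u - v) * (u + v) = u * u - v * v by ring.
    have -> : u * u = 1 - a1' * a1' - a2 * a2 by lra.
    have -> : v * v = 1 - b1' * b1' - b2 * b2 by lra.
    ring.
  have CS (s t s' t' : R) : (s * s' + t * t') ^+ 2 <= (s ^+ 2 + t ^+ 2) * (s' ^+ 2 + t' ^+ 2).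
    rewrite -subr_ge0 (_ : _ - _ = (s * t' - t * s') ^+ 2) ?sqr_ge0//; ring.
  apply: le_trans (CS _ _ _ _) _.
  have -> : (b1' - a1') ^+ 2 + (b2 - a2) ^+ 2 = E.
    by rewrite /E/eucl2/frame_proj/= -/a1' -/a2 -/b1' -/b2; ring.
  rewrite mulrC ler_wpM2r//.
  have := sqr_ge0 (b1' - a1'); have := sqr_ge0 (b2 - a2); nra.
move=> h.
have : k ^+ 2 * (1 + 4 * r ^+ 2) <= 1.
  apply: (@le_trans _ _ (k ^+ 2 * (1 + (1 - k)))).
    by rewrite ler_wpM2l ?sqr_ge0// lerD2l /r; nra.
  apply: (@le_trans _ _ (k * (1 + (1 - k)))); last by nra.
  by rewrite ler_wpM2r; nra.
have k20 : 0 <= k ^+ 2 by exact: sqr_ge0.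
move=> kr.
have -> : (k ^+ 2 * sigma a b) ^+ 2 = k ^+ 2 * (k ^+ 2 * sigma a b ^+ 2) by ring.
apply: (@le_trans _ _ (k ^+ 2 * ((1 + 4 * r ^+ 2) * E))).
  by rewrite ler_wpM2l//; lra.
by rewrite mulrA ler_piMl.
Qed.

End frame.
End sphere_local.

(** * Upper density bound *)

Lemma bernoulli_ge (R : realDomainType) (t : R) n :
  0 <= t -> t <= 1 -> 1 - n%:R * t <= (1 - t) ^+ n.
Proof.
move=> t0 t1; elim: n => [|n IHn]; first by rewrite mul0r subr0 expr0.
rewrite exprS; apply: (@le_trans _ _ ((1 - t) * (1 - n%:R * t))); last first.
  by rewrite ler_wpM2l// subr_ge0.
have : 0 <= n%:R * (t * t) by rewrite !mulr_ge0.
rewrite -natr1; set m := n%:R; lra.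
Qed.

Lemma exists_pow_close (R : realFieldType) n (A c : R) : 0 <= A -> A < c ->
  exists k : R, [/\ 0 < k, k < 1 & A < c * k ^+ n].
Proof.
move=> A0 Ac; have c0 : 0 < c by lra.
have n2 : (0 : R) < n.+2%:R by rewrite ltr0n.
pose t : R := (c - A) / (c * n.+2%:R).
have cn : 0 < c * n.+2%:R by rewrite mulr_gt0.
have t0 : 0 < t by rewrite divr_gt0// subr_gt0.
have tE : c * (n.+2%:R * t) = c - A by rewrite /t; field; rewrite !gt_eqF.
have E2 : n.+2%:R = n%:R + 2 :> R by rewrite -addn2 natrD.
have nt0 : 0 <= n%:R * t by rewrite mulr_ge0// ltW.
rewrite E2 in tE.
have t12 : (n%:R + 2) * t <= 1.
  rewrite -(ler_pM2l c0) tE; lra.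
have t1 : t < 1 by lra.
exists (1 - t); split; [lra|lra|].
apply: (@lt_le_trans _ _ (c * (1 - n%:R * t))).
  have : 0 < c * t by rewrite mulr_gt0.
  lra.
rewrite ler_wpM2l// ?bernoulli_ge; lra.
Qed.

Section gluing_distance.
Context {R : realType} (g : pt R -> pt R).
Hypothesis gS1 : forall a, S1 a -> S1 (g a).
Implicit Types x y z : Zpt R.

Lemma S2_Zpt x : S2 (sval x).2. Proof. by case: x => p []. Qed.

Lemma S2_seam x : pz (sval x).2 == 0 -> S2 (g (sval x).2).
Proof. by move=> /eqP x0; have [] := gS1 (conj (S2_Zpt x) x0). Qed.

Local Open Scope ereal_scope.

Lemma Dfun_ge0 x y : 0 <= Dfun g x y.
Proof.
rewrite /Dfun; have := S2_Zpt x; have := S2_Zpt y.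
have := @S2_seam x; have := @S2_seam y.
case: (sval x) => [[] a]; case: (sval y) => [[] b] /= gb ga b1 a1.
- by rewrite lee_fin sigma_ge0.
- by case: ifPn => b0; rewrite ?leey// lee_fin; apply: sigma_ge0 => //; exact: gb.
- by case: ifPn => a0; rewrite ?leey// lee_fin; apply: sigma_ge0 => //; exact: ga.
- case: ifPn => [/andP[a0 b0]|_]; rewrite lee_fin ?le_min sigma_ge0//=.
  by apply: sigma_ge0; [exact: ga|exact: gb].
Qed.

Lemma chain_sum_ge0 x s : 0 <= chain_sum g x s.
Proof. by elim: s x => //= y s IHs x; rewrite adde_ge0 ?Dfun_ge0. Qed.

Lemma dZ_ge0 x y : 0 <= dZ g x y.
Proof. by apply: le_ereal_inf_tmp => _ [s _ <-]; exact: chain_sum_ge0. Qed.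

Lemma dZ_le_chain x s : (0 < size s)%N -> dZ g x (last x s) <= chain_sum g x s.
Proof. by move=> s0; apply: ereal_inf_lbound; exists s. Qed.

Lemma dZ_le_Dfun x y : dZ g x y <= Dfun g x y.
Proof. by have := @dZ_le_chain x [:: y] isT; rewrite /= adde0. Qed.

Lemma dZ_le_Dfun2 x y z : dZ g x z <= Dfun g x y + Dfun g y z.
Proof. by have := @dZ_le_chain x [:: y; z] isT; rewrite /= adde0. Qed.

End gluing_distance.

Section density_upper_bound.
Context {R : realType} (g : pt R -> pt R) (psi : Zpt R -> pt R) (L : R).
Hypothesis gS1 : forall a, S1 a -> S1 (g a).
Hypothesis psiL : biLip_homeo_to_S2 g psi L.
Implicit Types x y z : Zpt R.

Lemma biLip_homeo_const_gt0 : 0 < L.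
Proof.
have [psiS psi_surj psi_lip] := psiL.
have nS : S2 ((0, 0, 1) : pt R) by rewrite /S2/dot/px/py/pz/=; ring.
have sS : S2 ((0, 0, -1) : pt R) by rewrite /S2/dot/px/py/pz/=; ring.
have [x xn] := psi_surj _ nS; have [y ys] := psi_surj _ sS.
have [+ _] := psi_lip x y; rewrite xn ys /sigma.
rewrite (_ : dot _ _ = -1); last by rewrite /dot/px/py/pz/=; ring.
rewrite acosN1 ltNge => h; apply/negP => L0.
have : (pi%:E <= (0 : \bar R))%E.
  by apply: (le_trans h); rewrite mule_le0_ge0 ?dZ_ge0 ?lee_fin.
by rewrite lee_fin leNgt pi_gt0.
Qed.

(** The ball is sent by [psi] and an orthographic projection into a disc of radius [L * r]; a cover
    of that disc is pulled back with dilation [L / k ^+ 2]. *)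
Lemma hausdorff2_cballZ_le x (k eta r : R) : 0 < k -> k < 1 -> 1 < eta ->
  0 < r -> L * r <= (1 - k) / 4 ->
  (hausdorff2 (dZ g) (cballZ g x r) <= (pi / 4 * ((L / k ^+ 2) ^+ 2 * (4 * eta * (L * r) ^+ 2)))%:E)%E.
Proof.
move=> k0 k1 eta1 r0 rk; have [psiS psi_surj psi_lip] := psiL.
have L0 := biLip_homeo_const_gt0.
have Lr0 : 0 < L * r by rewrite mulr_gt0.
have k20 : 0 < k ^+ 2 by rewrite exprn_gt0.
have [e1 [e2 fr]] := orthonormal_frame (psiS x).
pose l := L / k ^+ 2.
have l0 : 0 < l by rewrite divr_gt0.
apply: ge_ereal_sup => _ [delta delta0 <-].
have dl0 : 0 < delta / l by rewrite divr_gt0.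
rewrite (_ : delta = l * (delta / l)); last by field; rewrite gt_eqF.
apply: fincov_hausdorff2_delta; first by rewrite mulr_ge0// ltW.
have near_x z : cballZ g x r z -> sigma (psi x) (psi z) <= L * r.
  move=> xz; rewrite -lee_fin; have [h _] := psi_lip x z.
  by apply: (le_trans h); rewrite EFinM lee_wpmul2l// lee_fin ltW.
have := @fincov_preimage _ _ _ (fun e y z => (dZ g y z <= e%:E)%E) _ (cballZ g x r)
  (frame_proj e1 e2 \o psi) l (delta / l) _ _ (ltW l0) _ (fincov_disc eta1 dl0 Lr0).
move=> /(_ _)/fincovS; apply=> //.
- by rewrite mulr_ge0 ?(ltW l0) ?(ltW dl0).
- move=> z xz; split => //=.
  apply: le_trans (frame_proj_norm (psiS x) fr (psiS z)) _.
  by rewrite ler_sqr ?nnegrE ?sigma_ge0// ?(ltW Lr0)//; exact: near_x.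
- move=> e y z e0 /near_x xy /near_x xz; rewrite /enear => h.
  have [_ hyz] := psi_lip y z; apply: (le_trans hyz); rewrite lee_fin.
  have := sigma_le_frame_proj (psiS x) fr k0 k1 (psiS y) (psiS z) (le_trans xy rk) (le_trans xz rk).
  move=> /le_trans/(_ h).
  rewrite ler_sqr ?nnegrE//; last first.
    by apply: mulr_ge0; [exact: ltW|exact: sigma_ge0].
  move=> kse.
  by rewrite /l -mulrA ler_wpM2l ?(ltW L0)// mulrC ler_pdivlMr// mulrC.
Qed.

Lemma density_le x :
  (liminf0 (fun r => hausdorff2 (dZ g) (cballZ g x r) * ((pi * r ^+ 2)^-1)%:E)
     <= (L ^+ 4)%:E)%E.
Proof.
have L0 := biLip_homeo_const_gt0.
apply/lee_addgt0Pr => e e0.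
have L4 : 0 <= L ^+ 4 by rewrite exprn_ge0// ltW.
(* Exponent 5: four powers come from the squared dilation, one from [eta = k^-1]. *)
have [|k [k0 k1 kL]] := @exists_pow_close R 5 (L ^+ 4) (L ^+ 4 + e) L4; first by lra.
apply: ge_ereal_sup => _ [delta delta0 <-].
pose r := Num.min (delta / 2) ((1 - k) / (4 * L)).
have k10 : 0 < 1 - k by lra.
have r0 : 0 < r by rewrite lt_min !divr_gt0 ?mulr_gt0//; lra.
have rd : r < delta.
  have : r <= delta / 2 by rewrite ge_min lexx.
  lra.
have rk : L * r <= (1 - k) / 4.
  have : r <= (1 - k) / (4 * L) by rewrite ge_min lexx orbT.
  by rewrite ler_pdivlMr ?mulr_gt0//; lra.
apply: (@le_trans _ _ (hausdorff2 (dZ g) (cballZ g x r) * ((pi * r ^+ 2)^-1)%:E)%E).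
  by apply: ereal_inf_lbound; exists r => //=; rewrite r0.
have pr : 0 < pi * r ^+ 2 by rewrite mulr_gt0 ?pi_gt0 ?exprn_gt0.
have k1' : 1 < k^-1 by rewrite -[ltLHS]invr1 ltf_pV2 ?posrE.
apply: (le_trans (lee_wpmul2r _ (hausdorff2_cballZ_le x k0 k1 k1' r0 rk))).
  by rewrite lee_fin invr_ge0 ltW.
rewrite -EFinM lee_fin.
clearbody r; rewrite (_ : _ / _ = L ^+ 4 / k ^+ 5); last first.
  by move: (pi : R) (@pi_gt0 R) => P P0; field; rewrite !gt_eqF.
by rewrite ler_pdivrMr ?exprn_gt0// ltW.
Qed.

End density_upper_bound.

(** * Cone extension of circle maps *)

Section cone.
Context {R : realType}.
Implicit Types (a b c : pt R) (g : pt R -> pt R) (L k : R).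

Definition equator_proj a : pt R :=
  let s := Num.sqrt (1 - pz a ^+ 2) in (px a / s, py a / s, 0).

(* Acts by [g] on longitudes and preserves latitudes; at the poles, where
   [equator_proj] is a junk value, it is the identity. *)
Definition cone g a : pt R :=
  let s := Num.sqrt (1 - pz a ^+ 2) in
  if s == 0 then a else
  (s * px (g (equator_proj a)), s * py (g (equator_proj a)), pz a).

Lemma S2_sqr_pz a : S2 a -> px a ^+ 2 + py a ^+ 2 = 1 - pz a ^+ 2.
Proof. by rewrite /S2/dot => <-; ring. Qed.

Lemma sqr_sqrt_pz a : S2 a -> Num.sqrt (1 - pz a ^+ 2) ^+ 2 = 1 - pz a ^+ 2.
Proof. by move=> a1; rewrite sqr_sqrtr// -S2_sqr_pz// addr_ge0 ?sqr_ge0. Qed.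

Lemma S1_equator_proj a : S2 a -> Num.sqrt (1 - pz a ^+ 2) != 0 ->
  S1 (equator_proj a).
Proof.
move=> a1 s0; split => //; have := S2_sqr_pz a1; have := sqr_sqrt_pz a1.
rewrite /equator_proj; set s := Num.sqrt _ in s0 *; rewrite /S2/dot/px/py/pz/= => s2 h.
rewrite (_ : _ + _ = (a.1.1 ^+ 2 + a.1.2 ^+ 2) / s ^+ 2); last by field.
by rewrite h -s2 divff// expf_neq0.
Qed.

Lemma pz_cone g a : pz (cone g a) = pz a.
Proof. by rewrite /cone; case: ifP. Qed.

Lemma S1_sqr c : S1 c -> px c ^+ 2 + py c ^+ 2 = 1.
Proof. by move=> [/S2_sqr_pz -> ->]; rewrite expr0n subr0. Qed.

Lemma S2_cone g a : (forall c, S1 c -> S1 (g c)) -> S2 a -> S2 (cone g a).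
Proof.
move=> gS1 a1; rewrite /cone; case: eqVneq => // s0.
have := S1_sqr (gS1 _ (S1_equator_proj a1 s0)); have := sqr_sqrt_pz a1.
set s := Num.sqrt _; rewrite /S2/dot/px/py/pz/= => s2 h.
set c := g _ in h *.
rewrite (_ : _ + _ = s ^+ 2 * (c.1.1 ^+ 2 + c.1.2 ^+ 2) + a.2 ^+ 2); last by ring.
by rewrite h s2 mulr1 subrK.
Qed.

Lemma cone_equator g a : S1 (g a) -> S1 a -> cone g a = g a.
Proof.
move=> ga [a1 a0]; rewrite /cone /equator_proj a0 expr0n subr0 sqrtr1 oner_eq0.
have -> : (px a / 1, py a / 1, 0) = a.
  by case: a a1 a0 ga => [[x y] z] _ /= -> _; rewrite /px/py/= !divr1.
by case: (g a) ga => [[x y] z] [_ /= ->]; rewrite /px/py/= !mul1r.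
Qed.

Lemma equator_proj_cone g a : (forall c, S1 c -> S1 (g c)) -> S2 a ->
  Num.sqrt (1 - pz a ^+ 2) != 0 -> equator_proj (cone g a) = g (equator_proj a).
Proof.
move=> gS1 a1 s0; have [_ g0] := gS1 _ (S1_equator_proj a1 s0).
rewrite /equator_proj pz_cone /cone (negbTE s0).
move: g0; rewrite -/(equator_proj a); case: (g _) => [[x y] z] /= ->.
by rewrite /px/py/=; congr (_, _, _); field.
Qed.

Lemma cone_cancel g g' a : (forall c, S1 c -> S1 (g c)) ->
  (forall c, S1 c -> g' (g c) = c) -> S2 a -> cone g' (cone g a) = a.
Proof.
move=> gS1 gK a1; rewrite {1}/cone pz_cone.
case: eqVneq => [s0|s0]; first by rewrite /cone s0 eqxx.
rewrite equator_proj_cone// gK; last exact: S1_equator_proj.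
case: a a1 s0 => [[x y] z] a1 s0; rewrite /equator_proj/px/py/pz/= in s0 *.
by congr (_, _, _); field.
Qed.

(** Spherical law of cosines: [t] is the product of the cosines of the two latitudes, and
    [pz a * pz b + t] the cosine of their difference. The first alternative covers the poles, which
    have no longitude. *)
Lemma dot_cone g a b : S2 a -> S2 b ->
  (forall c, S1 c -> S1 (g c)) -> exists2 t, 0 <= t &
  t = 0 /\ dot (cone g a) (cone g b) = dot a b \/
  let a' := equator_proj a in let b' := equator_proj b in
  [/\ S1 a', S1 b', pz a * pz b + t <= 1,
    dot a b = pz a * pz b + t * dot a' b' &
    dot (cone g a) (cone g b) = pz a * pz b + t * dot (g a') (g b')].
Proof.
move=> a1 b1 gS1.
have [s0|s0] := eqVneq (Num.sqrt (1 - pz a ^+ 2)) 0.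
  exists 0 => //; left; split => //.
  have := sqr_sqrt_pz a1; rewrite s0 expr0n/= -S2_sqr_pz// => /esym/eqP.
  rewrite paddr_eq0 ?sqr_ge0// !sqrf_eq0 => /andP[/eqP x0 /eqP y0].
  by rewrite /dot pz_cone /cone s0 eqxx x0 y0 !mul0r !add0r pz_cone.
have [t0|t0] := eqVneq (Num.sqrt (1 - pz b ^+ 2)) 0.
  exists 0 => //; left; split => //.
  have := sqr_sqrt_pz b1; rewrite t0 expr0n/= -S2_sqr_pz// => /esym/eqP.
  rewrite paddr_eq0 ?sqr_ge0// !sqrf_eq0 => /andP[/eqP x0 /eqP y0].
  by rewrite /dot !pz_cone {2 4}/cone t0 eqxx x0 y0 !mulr0 !add0r.
exists (Num.sqrt (1 - pz a ^+ 2) * Num.sqrt (1 - pz b ^+ 2)).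
  by rewrite mulr_ge0 ?sqrtr_ge0.
right => a' b'.
have a'1 : S1 a' by exact: S1_equator_proj.
have b'1 : S1 b' by exact: S1_equator_proj.
have [[_ ga0] [_ gb0]] := (gS1 _ a'1, gS1 _ b'1).
split => //.
- have := sqr_sqrt_pz a1; have := sqr_sqrt_pz b1.
  move: (Num.sqrt _) (Num.sqrt _) => t s t2 s2.
  have := sqr_ge0 (pz a - pz b); have := sqr_ge0 (s - t); nra.
- rewrite /a' /b' /equator_proj; clear a' b' a'1 b'1 ga0 gb0.
  move: (Num.sqrt (1 - pz a ^+ 2)) s0 (Num.sqrt (1 - pz b ^+ 2)) t0 => s s0 t t0.
  by rewrite /dot/px/py/pz/=; field; rewrite s0 t0.
- rewrite /dot !pz_cone /cone (negbTE s0) (negbTE t0) -/a' -/b' ga0 gb0.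
  by rewrite /px/py/pz/=; ring.
Qed.

(* The chordal distance is where the cone extension keeps the Lipschitz
   constant: [1 - <a, b>] splits into a part that does not see [g] and a
   nonnegative multiple of its value at the equatorial projections. *)
Lemma chord2_cone g L a b : 1 <= L -> (forall c, S1 c -> S1 (g c)) ->
  (forall a b, S1 a -> S1 b -> sigma (g a) (g b) <= L * sigma a b) ->
  S2 a -> S2 b -> chord2 (cone g a) (cone g b) <= L ^+ 2 * chord2 a b.
Proof.
move=> L1 gS1 gL a1 b1.
have L21 : 1 <= L ^+ 2 by rewrite exprn_ege1.
have ca1 := S2_cone gS1 a1; have cb1 := S2_cone gS1 b1.
have [t t0 [[_ E]|[a'1 b'1 zt E E']]] := dot_cone a1 b1 gS1.
  rewrite !chord2_dot// E ler_peMl// mulr_ge0// subr_ge0.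
  by have /andP[] := dot_bound a1 b1.
move: E E' a'1 b'1; set a' := equator_proj a; set b' := equator_proj b => E E' a'1 b'1.
have [[a'2 _] [b'2 _]] := (a'1, b'1).
have [[ga1 _] [gb1 _]] := (gS1 _ a'1, gS1 _ b'1).
have key : chord2 (g a') (g b') <= L ^+ 2 * chord2 a' b'.
  rewrite !chord2_sigma//.
  have d0 := sigma_ge0 a'2 b'2; have dpi := sigma_le_pi a'2 b'2.
  have e0 := sigma_ge0 ga1 gb1; have epi := sigma_le_pi ga1 gb1.
  have := gL _ _ a'1 b'1.
  move: (sigma a' b') (sigma (g a') (g b')) d0 dpi e0 epi => d e d0 dpi e0 epi ed.
  suff h : sin (e / 2) <= L * sin (d / 2).
    have : 0 <= sin (e / 2) by rewrite sin_ge0_pi//; apply/andP; split; lra.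
    nra.
  have sd0 : 0 <= sin (d / 2) by rewrite sin_ge0_pi//; apply/andP; split; lra.
  have [d00|dN0] := eqVneq d 0.
    have -> : e = 0 by rewrite d00 mulr0 in ed; lra.
    by rewrite mul0r sin0 mulr_ge0//; lra.
  have dp : 0 < d by rewrite lt_neqAle eq_sym dN0.
  have pi0 := @pi_gt0 R.
  have [ed'|/ltW de] := leP e d.
    apply: (@le_trans _ _ (sin (d / 2))); last by rewrite ler_peMl.
    rewrite -!cosBpihalf -[leRHS]cosN -[leLHS]cosN cos_le_mono; lra.
  (* [sin_mul_le] is used with the actual ratio [e / d] in place of [L], since [L * (d / 2)] may
     exceed [pi / 2]. *)
  have eE : e / 2 = (e / d) * (d / 2) by field.
  rewrite eE; apply: (@le_trans _ _ ((e / d) * sin (d / 2))).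
    apply: sin_mul_le; first by rewrite ler_pdivlMr// mul1r.
      by lra.
    by rewrite -eE; lra.
  by rewrite ler_wpM2r// ler_pdivrMr.
rewrite !chord2_dot// in key; rewrite !chord2_dot// E E'.
have : t * (1 - dot (g a') (g b')) <= t * (L ^+ 2 * (1 - dot a' b')).
  by rewrite ler_wpM2l//; lra.
have : 0 <= (L ^+ 2 - 1) * (1 - (pz a * pz b + t)) by apply: mulr_ge0; lra.
lra.
Qed.

End cone.

(** * Geodesics: midpoints, arc-length estimates, crossing the equator *)

Section geodesics.
Context {R : realType}.
Implicit Types (a b c : pt R) (L k : R).

(** The normalized sum of [a] and [b], whose norm [2 * cos (sigma a b / 2)] is nonzero short of
    antipodality. The statement on [pz m] keeps midpoints in the hemisphere of the endpoints. *)
Lemma geodesic_midpoint a b : S2 a -> S2 b -> sigma a b < pi ->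
  exists m, [/\ S2 m, exists2 t, 0 < t & pz m = t * (pz a + pz b),
    sigma a m = sigma a b / 2 & sigma m b = sigma a b / 2].
Proof.
move=> a1 b1 abpi; have ab0 := sigma_ge0 a1 b1.
pose c := cos (sigma a b / 2).
have c0 : 0 < c by rewrite cos_gt0_pihalf//; apply/andP; split; lra.
have c2 : 2 * c ^+ 2 = 1 + dot a b.
  rewrite -cos_sigma// {1}(_ : sigma a b = (sigma a b / 2) *+ 2); last first.
    by rewrite -mulr_natr divfK.
  by rewrite cos_mulr2n -/c; ring.
have sK (x : R) : x = c -> acos x = sigma a b / 2.
  by move=> ->; rewrite cosK// in_itv/=; apply/andP; split; lra.
clearbody c.
exists ((px a + px b) / (2 * c), (py a + py b) / (2 * c), (pz a + pz b) / (2 * c)).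
have c20 : 2 * c != 0 by rewrite gt_eqF// mulr_gt0.
split.
- rewrite /S2 (_ : dot _ _ = (dot a a + dot b b + 2 * dot a b) / (2 * c) ^+ 2); last first.
    by rewrite /dot/px/py/pz/=; field; rewrite gt_eqF.
  have -> : dot a a + dot b b + 2 * dot a b = (2 * c) ^+ 2 by rewrite a1 b1; lra.
  by rewrite divff// expf_neq0.
- by exists (2 * c)^-1; [rewrite invr_gt0 mulr_gt0|rewrite [RHS]mulrC].
- apply: sK; rewrite (_ : dot _ _ = (dot a a + dot a b) / (2 * c)); last first.
    by rewrite /dot/px/py/pz/=; field; rewrite gt_eqF.
  by rewrite a1 -c2; field; rewrite gt_eqF.
- apply: sK; rewrite (_ : dot _ _ = (dot b b + dot a b) / (2 * c)); last first.
    by rewrite /dot/px/py/pz/=; field; rewrite gt_eqF.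
  by rewrite b1 -c2; field; rewrite gt_eqF.
Qed.

(* Halve the geodesic until arcs and chords are comparable with a constant
   close to 1; [H] is closed under midpoints. *)
Lemma chord_Lipschitz_sigma (H : set (pt R)) (h : pt R -> pt R) L : 0 < L ->
  (forall a, H a -> S2 a) -> (forall a, H a -> S2 (h a)) ->
  (forall a b m t, H a -> H b -> S2 m -> 0 < t -> pz m = t * (pz a + pz b) -> H m) ->
  (forall a b, H a -> H b -> chord2 (h a) (h b) <= L ^+ 2 * chord2 a b) ->
  forall a b, H a -> H b -> sigma a b < pi -> sigma (h a) (h b) <= L * sigma a b.
Proof.
move=> L0 HS hS Hmid hL.
have pi0 := @pi_gt0 R.
have loc k a b : 0 < k -> k < 1 -> H a -> H b ->
    pi / 2 * L * sigma a b <= 1 - k -> k * sigma (h a) (h b) <= L * sigma a b.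
  move=> k0 k1 Ha Hb abk.
  have [a1 b1 ha1 hb1] := And4 (HS _ Ha) (HS _ Hb) (hS _ Ha) (hS _ Hb).
  have s0 := sigma_ge0 a1 b1; have hs0 := sigma_ge0 ha1 hb1.
  have cL : chord2 (h a) (h b) <= (L * sigma a b) ^+ 2.
    rewrite exprMn; apply: le_trans (hL _ _ Ha Hb) _.
    by rewrite ler_wpM2l ?sqr_ge0// chord2_le.
  have Ls0 : 0 <= L * sigma a b by rewrite mulr_ge0// ltW.
  have small : sigma (h a) (h b) <= 1 - k.
    apply: le_trans abk; rewrite -ler_sqr ?nnegrE//; last first.
      by rewrite !mulr_ge0//; lra.
    apply: le_trans (sigma_le_pihalf_chord ha1 hb1) _.
    by rewrite -(mulrA (pi / 2)) [leRHS]exprMn ler_wpM2l ?sqr_ge0.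
  have := sigma_le_chord k0 k1 ha1 hb1 small => /le_trans/(_ cL).
  by rewrite -exprMn ler_sqr ?nnegrE// mulr_ge0// ltW.
have step k n a b : 0 < k -> k < 1 -> H a -> H b -> sigma a b < pi ->
    pi / 2 * L * sigma a b <= 2 ^+ n * (1 - k) -> k * sigma (h a) (h b) <= L * sigma a b.
  move=> k0 k1; elim: n a b => [|n IHn] a b Ha Hb abpi.
    by rewrite expr0 mul1r; exact: loc.
  rewrite exprS => abn.
  have [m [m1 [t t0 mz] am mb]] := geodesic_midpoint (HS _ Ha) (HS _ Hb) abpi.
  have Hm := Hmid _ _ _ _ Ha Hb m1 t0 mz.
  have ab0 := sigma_ge0 (HS _ Ha) (HS _ Hb).
  have := IHn a m Ha Hm; have := IHn m b Hm Hb; rewrite am mb => h1 h2.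
  have {h1} := h1 _ _; have {h2} := h2 _ _.
  have : k * sigma (h a) (h b) <= k * (sigma (h a) (h m) + sigma (h m) (h b)).
    by rewrite ler_wpM2l ?(ltW k0)// sigma_triangle; auto.
  move=> h0 h1 h2; have {}h1 := h1 ltac:(lra) ltac:(lra); have {}h2 := h2 ltac:(lra) ltac:(lra).
  lra.
move=> a b Ha Hb abpi.
have ab0 := sigma_ge0 (HS _ Ha) (HS _ Hb).
have hab0 := sigma_ge0 (hS _ Ha) (hS _ Hb).
rewrite leNgt; apply/negP => lt.
have Ls0 : 0 <= L * sigma a b by rewrite mulr_ge0// ltW.
have [k [k0 k1]] := exists_pow_close 1 Ls0 lt.
rewrite expr1 ltNge => /negP; apply.
pose n := Num.truncn ((pi / 2 * L * sigma a b) / (1 - k)).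
have k10 : 0 < 1 - k by lra.
rewrite mulrC; apply: (step k n.+1) => //.
have q0 : 0 <= (pi / 2 * L * sigma a b) / (1 - k).
  apply: divr_ge0; last exact: ltW.
  by rewrite -(mulrA (pi / 2)); apply: mulr_ge0 => //; lra.
rewrite -ler_pdivrMr//.
have /andP[_ /ltW h1] := truncn_itv q0; apply: (le_trans h1).
by rewrite -natrX ler_nat ltnW// ltn_expl.
Qed.

(** The nonnegative combination [v] of [a] and [b] with vanishing third coordinate is normalized. It
    can vanish only for antipodal points, and then every equatorial point lies on a geodesic between
    them. *)
Lemma equator_crossing a b : S2 a -> S2 b -> pz a <= 0 -> 0 < pz b ->
  exists2 c, S1 c & sigma a c + sigma c b <= sigma a b.
Proof.
move=> a1 b1 a0 b0.
pose al := - pz a; pose be := pz b; set k := dot a b.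
have al0 : 0 <= al by rewrite oppr_ge0.
pose n2 := be ^+ 2 + al ^+ 2 + 2 * al * be * k.
pose v : pt R := (be * px a + al * px b, be * py a + al * py b, 0).
have vE c : dot c v = be * dot c a + al * dot c b.
  by rewrite /dot/px/py/pz/v/al/be/=; ring.
have vvE : dot v v = n2.
  by rewrite vE !(dotC v) !vE a1 b1 (dotC b) -/k /n2; ring.
have /andP[kN1 k1] : -1 <= k <= 1 by exact: dot_bound.
have n20 : 0 <= n2 by rewrite -vvE /dot !addr_ge0// -expr2 sqr_ge0.
have pi0 := @pi_gt0 R.
have [n0|nN0] := eqVneq n2 0.
  have kE : k = -1.
    have : 0 <= al * be * (1 + k) by rewrite !mulr_ge0//; [exact: ltW|lra].
    have := sqr_ge0 (al - be); rewrite /n2 in n0 => h1 h2.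
    have /eqP : (al - be) ^+ 2 = 0 by clearbody al be k; lra.
    rewrite sqrf_eq0 subr_eq0 => /eqP abe.
    have be2 : 0 < be ^+ 2 by rewrite exprn_gt0.
    have : be ^+ 2 * (1 + k) = 0 by rewrite abe in n0; clearbody be k; lra.
    by move=> /eqP; rewrite mulf_eq0 (gt_eqF be2)/= => /eqP; clear; lra.
  have opp : chord2 a (- px b, - py b, - pz b) = 0.
    rewrite (_ : chord2 _ _ = dot a a + dot b b + 2 * k).
      by rewrite a1 b1 kE; ring.
    by rewrite /k/chord2/dot/px/py/pz/=; ring.
  have bE : forall c, dot c b = - dot a c.
    move=> c; move: opp => /eqP; rewrite /chord2 paddr_eq0 ?addr_ge0 ?sqr_ge0//.
    rewrite paddr_eq0 ?sqr_ge0// !sqrf_eq0/= !subr_eq0 => /andP[/andP[/eqP ax /eqP ay] /eqP az].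
    by rewrite /dot ax ay az; rewrite /px/py/pz/=; ring.
  exists (1, 0, 0); first by split => //; rewrite /S2/dot/px/py/pz/=; ring.
  rewrite /sigma bE acosN; last first.
    by apply: dot_bound => //; rewrite /S2/dot/px/py/pz/=; ring.
  by rewrite -/k kE acosN1; lra.
have np : 0 < n2 by rewrite lt_neqAle eq_sym nN0.
pose n := Num.sqrt n2.
have n0 : 0 < n by rewrite sqrtr_gt0.
have nE : n ^+ 2 = n2 by rewrite sqr_sqrtr.
pose c : pt R := (px v / n, py v / n, 0).
have cE d : dot d c = dot d v / n.
  by rewrite /dot/c/v/px/py/pz/=; field; rewrite gt_eqF.
have c1 : S2 c.
  by rewrite /S2 cE dotC cE vvE -nE; field; rewrite gt_eqF.
exists c; first by split.
pose w := sin (sigma a b).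
have w0 : 0 <= w by exact: sin_sigma_ge0.
have w2 : w ^+ 2 = 1 - k ^+ 2 by exact: sqr_sin_sigma.
have ac : dot a c = (be + al * k) / n by rewrite cE vE a1 -/k; ring.
have cb : dot c b = (be * k + al) / n by rewrite dotC cE vE b1 dotC -/k; ring.
have sac : sin (sigma a c) = al * w / n.
  apply/eqP; rewrite -(@eqrXn2 _ 2)// ?sin_sigma_ge0 ?divr_ge0 ?mulr_ge0// ?(ltW n0)//.
  rewrite sqr_sin_sigma// ac !expr_div_n exprMn w2 nE /n2; apply/eqP; field.
  by rewrite -/n2.
have scb : sin (sigma c b) = be * w / n.
  apply/eqP; rewrite -(@eqrXn2 _ 2)// ?sin_sigma_ge0 ?divr_ge0 ?mulr_ge0// ?(ltW n0) ?(ltW b0)//.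
  rewrite sqr_sin_sigma// cb !expr_div_n exprMn w2 nE /n2; apply/eqP; field.
  by rewrite -/n2.
have s0 : 0 < sigma a b.
  rewrite lt_neqAle sigma_ge0// andbT; apply/eqP => s0.
  have := chord2_sigma a1 b1; rewrite -s0 mul0r sin0 expr0n mulr0 => /eqP.
  rewrite /chord2 paddr_eq0 ?addr_ge0 ?sqr_ge0// sqrf_eq0 subr_eq0 => /andP[_ /eqP].
  by move=> ab; move: a0; rewrite ab leNgt b0.
have spi := sigma_le_pi a1 b1; have ypi := sigma_le_pi c1 b1.
have y0 := sigma_ge0 c1 b1.
(* The sine fixes the sign of [sigma a b - sigma c b]; after that the cosine identifies it with
   [sigma a c]. *)
have sin_diff : sin (sigma a b - sigma c b) = al * w / n.
  by rewrite sinB !cos_sigma// scb -/w -/k cb; ring.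
have cos_diff : cos (sigma a b - sigma c b) = dot a c.
  rewrite cosB !cos_sigma// scb -/w -/k cb ac.
  rewrite (_ : _ + _ = (k * (be * k + al) + w ^+ 2 * be) / n); last by ring.
  by rewrite w2; ring.
have ys : sigma c b <= sigma a b.
  rewrite leNgt; apply/negP => sy.
  have : 0 < sin (sigma c b - sigma a b) by rewrite sin_gt0_pi//; apply/andP; split; lra.
  rewrite -opprB sinN sin_diff oppr_gt0 ltNge => /negP; apply.
  by rewrite divr_ge0 ?mulr_ge0// ltW.
have : sigma a c <= sigma a b - sigma c b.
  by apply: acos_le; rewrite ?dot_bound ?subr_ge0// cos_diff.
lra.
Qed.

End geodesics.

Lemma chord2_eq0 (R : realType) (a b : pt R) : chord2 a b = 0 -> a = b.
Proof.
move/eqP; rewrite /chord2 paddr_eq0 ?addr_ge0 ?sqr_ge0// paddr_eq0 ?sqr_ge0//.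
rewrite !sqrf_eq0 !subr_eq0; case: a b => [[a1 a2] a3] [[b1 b2] b3].
by rewrite /px/py/pz/= => /andP[/andP[/eqP -> /eqP ->] /eqP ->].
Qed.

(** * The bi-Lipschitz chart of the glued space *)

Section biLip_extension.
Context {R : realType} (g : pt R -> pt R) (L : R).
Hypothesis gS1 : forall a, S1 a -> S1 (g a).
Hypothesis g_surj : forall b, S1 b -> exists2 a, S1 a & g a = b.
Hypothesis gL : circle_biLip g L.
Implicit Types (a b c : pt R) (x y z : Zpt R).

(** On an antipodal pair the two estimates combine to [pi <= L ^+ 2 * pi]. *)
Lemma circle_biLip_ge1 : 1 <= L.
Proof.
have c1 (u : R) : S1 ((u, 0, 0) : pt R) <-> u * u = 1.
  by rewrite /S1/S2/dot/px/py/pz/= !mulr0 !addr0; split=> [[]|].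
have [p1 n1] : S1 ((1, 0, 0) : pt R) /\ S1 ((-1, 0, 0) : pt R).
  by split; apply/c1; rewrite ?mulr1// mulrNN mulr1.
have := gL p1 n1; set s := sigma _ _; set t := sigma _ _.
have -> : s = pi.
  by rewrite /s/sigma (_ : dot _ _ = -1) ?acosN1// /dot/px/py/pz/=; ring.
have t0 : 0 <= t by apply: sigma_ge0; [exact: (gS1 p1).1|exact: (gS1 n1).1].
have pi0 := @pi_gt0 R; move=> [h1 h2].
rewrite leNgt; apply/negP => L1.
have L0 : 0 < L by rewrite ltNge; apply/negP => L0; nra.
nra.
Qed.

Lemma circle_inverse : exists g', [/\ forall c, S1 c -> S1 (g' c),
  forall c, S1 c -> g (g' c) = c & forall c, S1 c -> g' (g c) = c].
Proof.
have L1 := circle_biLip_ge1.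
have /choice[g' g'P] : forall b, exists a, S1 b -> S1 a /\ g a = b.
  move=> b; have [b1|b1] := pselect (S1 b); last by exists b.
  by have [a a1 ab] := g_surj b1; exists a.
exists g'; split => [c /g'P[]//|c /g'P[]//|c c1].
have [g'c1 g'cE] := g'P _ (gS1 c1).
have [h _] := gL g'c1 c1; move: h; rewrite g'cE sigma_refl ?mulr0; last exact: (gS1 c1).1.
move=> h; have h0 : sigma (g' (g c)) c = 0.
  by apply/eqP; rewrite eq_le h sigma_ge0 ?g'c1.1 ?c1.1//; [exact: g'c1.1|exact: c1.1].
by apply: chord2_eq0; rewrite (chord2_sigma g'c1.1 c1.1) h0 mul0r sin0 expr0n mulr0.
Qed.

Let south : set (pt R) := [set a | S2 a /\ pz a <= 0].

Lemma cone_Lipschitz h a b : (forall a, S1 a -> S1 (h a)) ->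
  (forall a b, S1 a -> S1 b -> sigma (h a) (h b) <= L * sigma a b) ->
  S2 a -> S2 b -> pz a <= 0 -> pz b <= 0 ->
  sigma (cone h a) (cone h b) <= L * sigma a b.
Proof.
move=> hS1 hL a1 b1 a0 b0; have L1 := circle_biLip_ge1.
(* Antipodal points have no well-defined midpoint, but in the closed southern hemisphere they both
   lie on the equator, where the cone is [h] itself. *)
have [abpi|piab] := ltP (sigma a b) pi.
  apply: (@chord_Lipschitz_sigma R south (cone h) L _ _ _ _ _ a b) => //.
  - by lra.
  - by move=> c [].
  - by move=> c [c1 _]; exact: S2_cone.
  - move=> c d m t [_ c0] [_ d0] m1 t0 mz; split => //=; rewrite mz.
    by rewrite mulr_ge0_le0 ?(ltW t0)//; lra.
  - by move=> c d [c1 _] [d1 _]; apply: chord2_cone.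
have abE : sigma a b = pi by apply/eqP; rewrite eq_le sigma_le_pi.
have opp : dot a b = -1 by rewrite -cos_sigma// abE cospi.
have pzab : pz a + pz b = 0.
  have : chord2 a (- px b, - py b, - pz b) = 0.
    rewrite (_ : chord2 _ _ = dot a a + dot b b + 2 * dot a b).
      by rewrite a1 b1 opp; ring.
    by rewrite /chord2/dot/px/py/pz/=; ring.
  move=> /eqP; rewrite /chord2 paddr_eq0 ?addr_ge0 ?sqr_ge0// => /andP[_].
  by rewrite sqrf_eq0 {2}/pz/= opprK => /eqP.
have az : pz a = 0 by lra.
have bz : pz b = 0 by lra.
by rewrite !cone_equator//; [exact: hL|exact: hS1|exact: hS1].
Qed.

Definition gluing_chart x : pt R :=
  if (sval x).1 then (sval x).2 else cone g (sval x).2.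

Lemma S2_gluing_chart x : S2 (gluing_chart x).
Proof.
by rewrite /gluing_chart; case: ifP => _; [exact: S2_Zpt|apply/S2_cone/S2_Zpt].
Qed.

Local Open Scope ereal_scope.

Lemma gluing_chart_le_Dfun x y :
  (sigma (gluing_chart x) (gluing_chart y))%:E <= L%:E * Dfun g x y.
Proof.
have L1 := circle_biLip_ge1; have L0 : (0 < L)%R by lra.
have gL2 a b : S1 a -> S1 b -> (sigma (g a) (g b) <= L * sigma a b)%R.
  by move=> a1 b1; have [] := gL a1 b1.
have leL a b : S2 a -> S2 b -> (sigma a b <= L * sigma a b)%R.
  by move=> ? ?; rewrite ler_peMl ?sigma_ge0.
have inf (b : R) : (b%:E : \bar R) <= L%:E * +oo by rewrite gt0_muley ?lte_fin// leey.
rewrite /gluing_chart /Dfun; case: x => [[[] a] [/= a1 a0]]; case: y => [[[] b] [/= b1 b0]].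
- by rewrite lee_fin leL.
- case: ifPn => [/eqP b00|_]; last exact: inf.
  have b2 : S1 b by [].
  rewrite cone_equator ?lee_fin//; last exact: gS1.
  by apply: leL => //; exact: (gS1 b2).1.
- case: ifPn => [/eqP a00|_]; last exact: inf.
  have a2 : S1 a by [].
  rewrite cone_equator ?lee_fin//; last exact: gS1.
  by apply: leL => //; exact: (gS1 a2).1.
- case: ifPn => [/andP[/eqP a00 /eqP b00]|_]; last by rewrite lee_fin cone_Lipschitz.
  have a2 : S1 a by []. have b2 : S1 b by [].
  have [ga gb] := (gS1 a2, gS1 b2).
  rewrite !cone_equator// lee_fin minEle; case: ifP => _; first exact: gL2.
  by apply: leL; [exact: ga.1|exact: gb.1].
Qed.

Lemma gluing_chart_le_dZ x y :
  (sigma (gluing_chart x) (gluing_chart y))%:E <= L%:E * dZ g x y.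
Proof.
have L1 := circle_biLip_ge1; have L0 : (0 < L)%R by lra.
rewrite -lee_pdivrMl// -EFinM; apply: le_ereal_inf_tmp => _ [s [s0 <-] <-].
rewrite EFinM lee_pdivrMl//.
elim: s x {s0} => [|z s IHs] x /=; first by rewrite mule0 sigma_refl//; exact: S2_gluing_chart.
rewrite muleDr ?ge0_adde_def ?inE ?Dfun_ge0 ?chain_sum_ge0//.
apply: le_trans (leeD (gluing_chart_le_Dfun x z) (IHs z)).
by rewrite -EFinD lee_fin sigma_triangle//; exact: S2_gluing_chart.
Qed.

Lemma dZ_le_gluing_chart x y :
  dZ g x y <= (L * sigma (gluing_chart x) (gluing_chart y))%:E.
Proof.
have L1 := circle_biLip_ge1; have L0 : (0 < L)%R by lra.
have [g' [g'S1 gK g'K]] := circle_inverse.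
have g'L a b : S1 a -> S1 b -> (sigma (g' a) (g' b) <= L * sigma a b)%R.
  move=> a1 b1; have [h _] := gL (g'S1 _ a1) (g'S1 _ b1).
  by rewrite !gK// in h.
have leL a b : S2 a -> S2 b -> (sigma a b <= L * sigma a b)%R.
  by move=> ? ?; rewrite ler_peMl ?sigma_ge0.
have cL a b : S2 a -> S2 b -> (pz a <= 0 -> pz b <= 0 ->
    sigma a b <= L * sigma (cone g a) (cone g b))%R.
  move=> a1 b1 a0 b0.
  rewrite -{1}(cone_cancel gS1 g'K a1) -{1}(cone_cancel gS1 g'K b1).
  by apply: cone_Lipschitz; rewrite ?pz_cone//; apply: S2_cone.
have inS c : S1 c -> inZ (false, c) by case=> ? c0; split; rewrite //= c0.
(* The geodesic from [cone g a] to [b] meets the equator at [c], the northern name of the seam point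
   [g' c]; a chain with two links passes through it. *)
have cross a b : S2 a -> S2 b -> (pz a <= 0)%R -> (0 < pz b)%R -> exists2 c, S1 c &
    (sigma a (g' c) + sigma c b <= L * sigma (cone g a) b)%R.
  move=> a1 b1 a0 b0; have ca1 := S2_cone gS1 a1.
  have [|c c1 h] := equator_crossing ca1 b1 _ b0; first by rewrite pz_cone.
  exists c => //; apply: le_trans (ler_wpM2l (ltW L0) h); rewrite mulrDr lerD//.
    have g'c := g'S1 _ c1.
    have := cL _ _ a1 g'c.1 a0; rewrite g'c.2 lexx => /(_ isT).
    by rewrite (cone_equator _ g'c) ?gK.
  by apply: leL => //; exact: c1.1.
case: x => [[[] a] xP]; case: y => [[[] b] yP].
- apply: (le_trans (dZ_le_Dfun _ _ _)); rewrite /gluing_chart/= lee_fin.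
  by apply: leL; [case: xP|case: yP].
- have [[a1 a0] [b1 b0]] := (xP, yP).
  have [c c1 h] := cross b a b1 a1 b0 a0.
  apply: (le_trans (dZ_le_Dfun2 _ _ (exist _ _ (inS _ (g'S1 _ c1))) _)).
  have c0 := (g'S1 _ c1).2.
  rewrite /gluing_chart /Dfun/= c0 eqxx gK//= [in leRHS]sigmaC.
  case: ifPn => _; rewrite -EFinD lee_fin (le_trans _ h)// addrC (sigmaC c a) lerD2r (sigmaC b)//.
  by rewrite ge_min lexx.
- have [[a1 a0] [b1 b0]] := (xP, yP).
  have [c c1 h] := cross a b a1 b1 a0 b0.
  apply: (le_trans (dZ_le_Dfun2 _ _ (exist _ _ (inS _ (g'S1 _ c1))) _)).
  have c0 := (g'S1 _ c1).2.
  rewrite /gluing_chart /Dfun/= c0 eqxx gK//= andbT.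
  case: ifPn => _; rewrite -EFinD lee_fin (le_trans _ h)// lerD2r//.
  by rewrite ge_min lexx.
- have [[a1 a0] [b1 b0]] := (xP, yP).
  apply: (le_trans (dZ_le_Dfun _ _ _)); rewrite /gluing_chart/Dfun/=.
  by case: ifPn => _; rewrite lee_fin ?ge_min cL.
Qed.

Lemma gluing_chart_surj b : S2 b -> exists x, gluing_chart x = b.
Proof.
move=> b1; have [g' [g'S1 gK g'K]] := circle_inverse.
have [b0|b0] := ltP 0%R (pz b).
  have bP : inZ (true, b) by [].
  by exists (exist _ _ bP).
have bP : inZ (false, cone g' b) by split; rewrite /= ?pz_cone//; exact: S2_cone.
by exists (exist _ _ bP); rewrite /gluing_chart/= (cone_cancel g'S1 gK).
Qed.

Lemma biLip_homeo_gluing_chart : biLip_homeo_to_S2 g gluing_chart L.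
Proof.
split; [exact: S2_gluing_chart|exact: gluing_chart_surj|move=> x y].
by split; [exact: gluing_chart_le_dZ|exact: dZ_le_gluing_chart].
Qed.

End biLip_extension.

(** * Isodiametric inequality *)

Section upper_sum.
Context {R : realType}.

(* Trigonometric form of (b' - a') sqrt(1 - b'^2) <= area under the unit
   circle between abscissae a' = sin a and b' = sin b. *)
Lemma circle_strip_le (a b : R) : 0 <= a -> a <= b -> b <= pi / 2 ->
  cos b * (sin b - sin a) <= (sin b * cos b + b) / 2 - (sin a * cos a + a) / 2.
Proof.
move=> a0 ab b2; have pi0 := @pi_gt0 R.
have h1 := @sin_le_id R (b - a) ltac:(lra).
have h2 : 0 <= sin (a + b) by rewrite sin_ge0_pi//; apply/andP; split; lra.
have h3 := cos_le1 (b - a).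
rewrite sinB in h1; rewrite sinD in h2; rewrite cosB in h3.
have h : 0 <= (sin a * cos b + cos a * sin b) * (1 - (cos b * cos a + sin b * sin a)).
  by rewrite mulr_ge0// subr_ge0.
have ca := cos2Dsin2 a; have cb := cos2Dsin2 b.
move: (sin a) (cos a) (sin b) (cos b) h1 h2 h3 h ca cb => sa ca sb cb h1 h2 h3 h ea eb.
have E : (sa * cb + ca * sb) * (cb * ca + sb * sa) = sa * ca + sb * cb.
  have -> : (sa * cb + ca * sb) * (cb * ca + sb * sa) =
     sa * ca * (cb ^+ 2 + sb ^+ 2) + sb * cb * (ca ^+ 2 + sa ^+ 2) by ring.
  by rewrite ea eb; ring.
rewrite mulrBr mulr1 E in h; lra.
Qed.

(** Under the substitution [x = sin th], each strip is bounded by an increment of the primitive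
    [(sin th * cos th + th) / 2], and these telescope from 0 to [pi / 4]. *)
Lemma losum_le N : (0 < N)%N -> losum N <= pi / 4 :> R.
Proof.
move=> N0; have N0' : (0 : R) < N%:R by rewrite ltr0n.
pose th k : R := asin (k%:R / N%:R).
have kN k : (k <= N)%N -> -1 <= (k%:R / N%:R : R) <= 1.
  move=> kN; apply/andP; split; last by rewrite ler_pdivrMr// mul1r ler_nat.
  by rewrite (@le_trans _ _ 0)// divr_ge0.
pose G k : R := (sin (th k) * cos (th k) + th k) / 2.
have pi0 := @pi_gt0 R.
have th0 : th 0%N = 0.
  by rewrite /th mul0r -{1}sin0 sinK// in_itv/=; apply/andP; split; lra.
have thN : th N = pi / 2.
  by rewrite /th divff ?gt_eqF// -{1}sin_pihalf sinK// in_itv/=; apply/andP; split; lra.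
have sth k : (k <= N)%N -> sin (th k) = k%:R / N%:R.
  by move=> h; rewrite /th asinK// in_itv/= kN.
have cth k : (k <= N)%N -> cos (th k) = qcirc N k.
  by move=> h; rewrite /th cos_asin ?kN.
have thI k : (k <= N)%N -> th k \in `[- (pi / 2), pi / 2].
  by move=> h; rewrite in_itv/= asin_geNpi2 ?kN// asin_lepi2 ?kN.
have thM i k : (i <= k)%N -> (k <= N)%N -> th i <= th k.
  move=> ik h; have iN := leq_trans ik h.
  rewrite leNgt -ltr_sin ?thI// !sth// -leNgt ler_pM2r ?invr_gt0//.
  by rewrite ler_nat.
apply: (@le_trans _ _ (\sum_(k < N) (G k.+1 - G k))).
  apply: ler_sum => k _; have kn := ltn_ord k.
  have t0 : 0 <= th k by rewrite -th0 thM// ltnW.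
  have tk : th k <= th k.+1 by rewrite thM.
  have t1 : th k.+1 <= pi / 2 by rewrite -thN thM.
  have := circle_strip_le t0 tk t1.
  rewrite -/(G k) -/(G k.+1) cth// !sth//; last exact: ltnW.
  by rewrite -mulrBl -natrB// subSnn mul1r.
rewrite -(big_mkord xpredT (fun k => G k.+1 - G k)) telescope_sumr//.
rewrite /G th0 thN sin0 cos_pihalf; lra.
Qed.

Lemma upsum_le N : (0 < N)%N -> upsum N <= pi / 4 + N%:R^-1 :> R.
Proof. by move=> N0; have := losum_le N0; have := @upsumB R N N0; lra. Qed.

End upper_sum.

Section isodiametric.
Context {R : realType}.
Notation mu := (@lebesgue_measure R).

(* Two horizontal segments of width at least [t] contain, on one of the two
   diagonals, endpoints whose abscissae differ by at least [t]. *)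
Lemma wide_slices_le (V : set (R * R)) (d t y y' : R) :
  (forall p q, V p -> V q -> eucl2 p q <= d ^+ 2) ->
  (exists u u', [/\ V (u, y), V (u', y) & t <= u - u']) ->
  (exists u u', [/\ V (u, y'), V (u', y') & t <= u - u']) -> 0 <= t ->
  (y - y') ^+ 2 <= d ^+ 2 - t ^+ 2.
Proof.
move=> Vd [u1 [u2 [V1 V2 u12]]] [v1 [v2 [W1 W2 v12]]] t0.
have [h|h] := leP t (u1 - v2).
  by have := Vd _ _ V1 W2; rewrite /eucl2/=; nra.
have {}h : t <= v1 - u2 by lra.
by have := Vd _ _ W1 V2; rewrite /eucl2/=; nra.
Qed.

(** The sets of heights met below are not known to be measurable, but their closed interval hulls
    are, and only widths matter. The empty set gets the empty interval, as its [inf] and [sup] are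
    default values. *)
Definition hull (E : set R) : set R :=
  [set` if `[< E !=set0 >] then `[inf E, sup E] else `]0, 0[ ].

Lemma measurable_hull E : measurable (hull E).
Proof. exact: measurable_itv. Qed.

Lemma sub_hull E (w : R) : (forall y y', E y -> E y' -> y - y' <= w) -> E `<=` hull E.
Proof.
move=> Ew y Ey; rewrite /hull; case: asboolP => [_|[]]; last by exists y.
rewrite /= in_itv/=; apply/andP; split.
  by apply: ge_inf => //; exists (y - w) => z Ez; have := Ew _ _ Ey Ez; lra.
by apply: ub_le_sup => //; exists (y + w) => z Ez; have := Ew _ _ Ez Ey; lra.
Qed.

Lemma hull_measure_le E (w : R) : 0 <= w ->
  (forall y y', E y -> E y' -> y - y' <= w) -> (mu (hull E) <= w%:E)%E.
Proof.
move=> w0 Ew; rewrite /hull; case: asboolP => [[y Ey]|_]; last first.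
  by rewrite lebesgue_measure_itv/= ltxx lee_fin.
rewrite lebesgue_measure_itv/=; case: ifP => _; last by rewrite lee_fin.
rewrite -EFinB lee_fin lerBlDr -lerBlDl.
apply: lb_le_inf; first by exists y.
move=> z Ez; rewrite lerBlDl addrC -lerBlDl; rewrite lerBlDl; apply: ge_sup; first by exists y.
by move=> z' Ez'; have := Ew _ _ Ez' Ez; lra.
Qed.

Section cover.
Variables (V : nat -> set (R * R)) (d : nat -> R).
Hypothesis d0 : forall i, 0 <= d i.
Hypothesis Vd : forall i p q, V i p -> V i q -> eucl2 p q <= d i ^+ 2.
Variable n : nat.
Hypothesis n0 : (0 < n)%N.

Let E i (k : nat) : set R := [set y | exists u u',
  [/\ V i (u, y), V i (u', y) & k%:R / n%:R * d i <= u - u']].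

Let S i y : R := \sum_(k < n) d i / n%:R * \1_(hull (E i k)) y.

Let n0' : (0 : R) < n%:R. Proof. by rewrite ltr0n. Qed.

Let E_width i k : (k < n)%N -> forall y y', E i k y -> E i k y' ->
  y - y' <= d i * qcirc n k.
Proof.
move=> kn y y' Ey Ey'.
have kn0 : 0 <= k%:R / n%:R :> R by rewrite divr_ge0.
have kn1 : k%:R / n%:R <= 1 :> R by rewrite ler_pdivrMr// mul1r ler_nat ltnW.
have h := wide_slices_le (@Vd i) Ey Ey' (mulr_ge0 kn0 (d0 i)).
have q2 : qcirc n k ^+ 2 = 1 - (k%:R / n%:R) ^+ 2 :> R.
  by rewrite /qcirc sqr_sqrtr// subr_ge0 exprn_ile1.
have [yy|/ltW yy] := leP (y - y') 0.
  by apply: (le_trans yy); rewrite mulr_ge0// qcirc_ge0.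
rewrite -ler_sqr ?nnegrE ?mulr_ge0 ?qcirc_ge0// exprMn q2.
by apply: (le_trans h); rewrite exprMn; lra.
Qed.

Let slice_width i y u u' : V i (u, y) -> V i (u', y) -> u - u' <= S i y.
Proof.
move=> Vu Vu'.
have dn0 : 0 <= d i / n%:R by rewrite divr_ge0// ltW.
have [uu|uu] := leP (u - u') 0.
  by apply: (le_trans uu); apply: sumr_ge0 => k _; rewrite mulr_ge0// indicE.
have wd : u - u' <= d i.
  rewrite -ler_sqr ?nnegrE ?(ltW uu)//.
  by have := Vd Vu Vu'; rewrite /eucl2/= subrr expr0n addr0.
have dp : 0 < d i by lra.
pose w := u - u'.
have in_hull k : (k < n)%N -> k%:R * (d i / n%:R) <= w -> hull (E i k) y.
  move=> kn kw; apply: (sub_hull (E_width kn)); exists u, u'; split => //.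
  by apply: le_trans kw; rewrite mulrAC mulrA.
(* Truncating at [w] makes the layer sum inductive: a new layer either counts in full or starts
   above [w]. *)
have partial j : (j <= n)%N -> Num.min w (j%:R * (d i / n%:R)) <=
    \sum_(k < j) d i / n%:R * \1_(hull (E i k)) y.
  elim: j => [|j IHj] jn; first by rewrite mul0r big_ord0 ge_min lexx orbT.
  rewrite big_ord_recr/=; apply: le_trans (lerD (IHj (ltnW jn)) (lexx _)).
  rewrite -natr1 mulrDl mul1r.
  have [jw|wj] := leP (j%:R * (d i / n%:R)) w.
    rewrite indicE mem_set ?mulr1; last exact: in_hull.
    by rewrite ge_min lexx orbT.
  rewrite ge_min; apply/orP; left.
  by rewrite lerDl mulr_ge0// indicE.
have := partial n (leqnn n).
rewrite (_ : n%:R * (d i / n%:R) = d i); last by field; rewrite gt_eqF.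
by rewrite min_l.
Qed.

Let S_ge0 i y : 0 <= S i y.
Proof. by apply: sumr_ge0 => k _; rewrite mulr_ge0// ?indicE// divr_ge0// ltW. Qed.

Let slice_measure_le (y u0 l : R) :
  (forall u, u0 <= u <= u0 + l -> exists i, V i (u, y)) ->
  (l%:E <= \sum_(i <oo) (S i y)%:E)%E.
Proof.
move=> cov.
have S0E : (0%E <= \sum_(i <oo) (S i y)%:E)%E.
  by apply: nneseries_ge0 => i _ _; rewrite lee_fin.
have [l0|l0] := leP l 0; first by apply: le_trans S0E; rewrite lee_fin.
pose c i := inf [set u | V i (u, y)].
have -> : l%:E = mu `[u0, u0 + l].
  by rewrite lebesgue_measure_itv/= lte_fin ltrDl l0 -EFinB addrAC subrr add0r.
apply: (@le_trans _ _ (\sum_(i <oo) mu [set` `[c i, (c i + S i y)%R]])%E).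
  apply: measure_sigma_subadditive.
  - by move=> i; exact: measurable_itv.
  - exact: measurable_itv.
  move=> u /=; rewrite in_itv/= => /cov[i Viu]; exists i => //=.
  rewrite in_itv/=; apply/andP; split.
    apply: ge_inf => //; exists (u - S i y) => u' Vu'.
    by rewrite lerBlDl -lerBlDr; exact: slice_width.
  rewrite -lerBlDr; apply: lb_le_inf; first by exists u.
  by move=> u' Vu'; rewrite lerBlDl -lerBlDr; exact: slice_width.
apply: lee_nneseries => [//|i _]; rewrite lebesgue_measure_itv/=.
case: ifP => _; last by rewrite lee_fin.
by rewrite -EFinB addrAC subrr add0r.
Qed.

(* Isodiametric inequality, in the form needed for covers: the width of a slice
   is at most the sum over [k < n] of [d / n] times the indicator of the set of
   heights where it is at least [k d / n], and by [wide_slices_le] such a set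
   lies in an interval of length [d sqrt (1 - (k / n)^2)]. *)
Lemma cover_slices_le (y0 y1 : R) (l : R -> R) :
  measurable_fun `[y0, y1] l -> (forall y, y \in `[y0, y1] -> 0 <= l y) ->
  (forall y, y \in `[y0, y1] -> exists u0, forall u, u0 <= u <= u0 + l y ->
     exists i, V i (u, y)) ->
  (\int[mu]_(y in `[y0, y1]) (l y)%:E <= \sum_(i <oo) (upsum n * d i ^+ 2)%:E)%E.
Proof.
move=> ml l0 cov.
have mS i : measurable_fun `[y0, y1] (EFin \o S i).
  apply/measurable_EFinP; apply: measurable_sum => k.
  by apply: measurable_funM => //; apply: measurable_indic; exact: measurable_hull.
apply: (@le_trans _ _ (\int[mu]_(y in `[y0, y1]) \sum_(i <oo) (S i y)%:E)%E).
  apply: ge0_le_integral => //.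
  - exact/measurable_EFinP.
  - apply: (@ge0_emeasurable_sum _ _ _ _ (fun i y => (S i y)%:E) xpredT) => [k y _ _|k _].
      by rewrite lee_fin.
    exact: mS.
  - by move=> y yI; have [u0 h] := cov y yI; exact: slice_measure_le h.
rewrite integral_nneseries//; last by move=> i y _; rewrite lee_fin.
apply: lee_nneseries => [i _ _|i _].
  by apply: integral_ge0 => y _; rewrite lee_fin.
under eq_integral do rewrite /S -sumEFin.
have mk (k : nat) : measurable_fun (`[y0, y1] : set R) (EFin \o \1_(hull (E i k))).
  by apply/measurable_EFinP; apply: measurable_indic; exact: measurable_hull.
rewrite ge0_integral_sum//; last 2 first.
  move=> k; apply/measurable_EFinP; apply: measurable_funM => //.
  by apply: measurable_indic; exact: measurable_hull.
  by move=> k y _; rewrite lee_fin mulr_ge0// ?indicE// divr_ge0// ltW.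
rewrite /upsum mulr_suml -sumEFin; apply: lee_sum => k _.
under eq_integral do rewrite EFinM.
rewrite ge0_integralZl_EFin//; last 2 first.
  exact: mk.
  by rewrite divr_ge0// ltW.
rewrite integral_indic//; last exact: measurable_hull.
apply: (@le_trans _ _ ((d i / n%:R)%:E * (d i * qcirc n k)%:E)%E).
  rewrite lee_wpmul2l ?lee_fin ?divr_ge0 ?(ltW n0')//.
  apply: (@le_trans _ _ (mu (hull (E i k)))).
    apply: le_measure; rewrite ?inE; [|exact: measurable_hull|exact: subIsetl].
    by apply: measurableI; [exact: measurable_hull|exact: measurable_itv].
  by apply: hull_measure_le (E_width _) => //; rewrite mulr_ge0 ?qcirc_ge0.
by rewrite -EFinM lee_fin le_eqVlt; apply/orP; left; apply/eqP; ring.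
Qed.

End cover.
End isodiametric.

Section triangle.
Context {R : realType}.
Notation mu := (@lebesgue_measure R).

(** A region whose slices have the lengths [2 * A * (b - y)] has the area of a triangle, however the
    slices are shifted. The gap between [c] and [pi / 4] absorbs the error [n^-1] of the layer
    sums. *)
Lemma triangle_cover_le (V : nat -> set (R * R)) (d : nat -> R) (A y0 b c : R) :
  (forall i, 0 <= d i) ->
  (forall i p q, V i p -> V i q -> eucl2 p q <= d i ^+ 2) ->
  0 <= A -> y0 < b ->
  (forall y, y0 <= y <= b -> exists u0, forall u, u0 <= u <= u0 + 2 * A * (b - y) ->
     exists i, V i (u, y)) ->
  pi / 4 < c ->
  ((A * (b - y0) ^+ 2)%:E <= \sum_(i <oo) (c * d i ^+ 2)%:E)%E.
Proof.
move=> d0 Vd A0 yb cov c4.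
pose l y := 2 * A * (b - y).
pose n := (Num.truncn ((c - pi / 4)^-1)).+1.
have c40 : 0 < c - pi / 4 by rewrite subr_gt0.
have nc : upsum n <= c.
  apply: (le_trans (upsum_le _)) => //.
  rewrite -lerBrDl -[leRHS]invrK lef_pV2 ?posrE ?invr_gt0 ?ltr0n//.
  have /andP[_ /ltW] : (Num.truncn ((c - pi / 4)^-1))%:R <= (c - pi / 4)^-1 < n%:R.
    by apply: truncn_itv; rewrite invr_ge0 ltW.
  by [].
have cl : continuous l.
  move=> y; apply: cvgM; first exact: cvg_cst.
  by apply: cvgB; [exact: cvg_cst|exact: cvg_id].
have := @cover_slices_le R V d d0 Vd n isT y0 b l.
move=> /(_ (measurable_funS measurableT (subsetT _) (continuous_measurable_fun cl))).
have l0 y : y \in `[y0, b] -> 0 <= l y.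
  by rewrite in_itv/= => /andP[_ yb1]; rewrite /l !mulr_ge0// subr_ge0.
move=> /(_ l0) => H.
have {}H : (\int[mu]_(y in `[y0, b]) (l y)%:E <=
    \big[+%E/0%R]_(0 <= i <oo) (upsum n * d i ^+ 2)%:E)%E.
  by apply: H => y; rewrite in_itv/= => yI; exact: cov.
pose F (y : R) : R := - A * (b - y) ^+ 2.
have dF (y : R) : is_derive y 1 F (l y).
  rewrite /F /l; apply: is_derive_eq.
  rewrite /GRing.scale/= ; ring.
have cF : continuous F.
  by move=> y; apply/differentiable_continuous/derivable1_diffP; case: (dF y).
have intE : (\int[mu]_(y in `[y0, b]) (l y)%:E = (F b)%:E - (F y0)%:E)%E.
  apply: continuous_FTC2 => //.
  - exact: continuous_subspaceT.
  - split.
    + by move=> y _; case: (dF y).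
    + by apply: cvg_at_right_filter; exact: cF.
    + by apply: cvg_at_left_filter; exact: cF.
  - by move=> y _; rewrite derive1E; case: (dF y).
have -> : (A * (b - y0) ^+ 2)%:E = (\int[mu]_(y in `[y0, b]) (l y)%:E)%E.
  by rewrite intE /F -EFinB; congr EFin; ring.
apply: (le_trans H); apply: lee_nneseries => [i _ _|i _].
  by rewrite lee_fin mulr_ge0 ?sqr_ge0//; have := @upsum_ge R n isT; lra.
by rewrite lee_fin ler_wpM2r// sqr_ge0.
Qed.

End triangle.

(** * Symmetric slopes of increasing functions *)

Section vitali_slope.
Context {R : realType}.
Notation mu := (@lebesgue_measure R).
Variables (Phi : R -> R) (M : R).
Hypothesis Phi_cont : continuous Phi.
Hypothesis Phi_incr : forall s t, s < t -> Phi s < Phi t.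
Hypothesis M0 : 0 < M.
Hypothesis slope : forall t e, 0 < e ->
  exists2 s, 0 < s < e & Phi (t + s) - Phi (t - s) <= 2 * M * s.

Lemma continuous_eps_delta (f : R -> R) (t e : R) : continuous f -> 0 < e ->
  exists2 d, 0 < d & forall u, `|u - t| < d -> `|f u - f t| < e.
Proof.
move=> fc e0; have /cvgrPdist_lt/(_ _ e0)/nbhs_ballP[d /= d0 h] := fc t.
by exists d => // u ut; rewrite distrC; apply: h; rewrite /ball/= distrC.
Qed.

Lemma rat_between (x y : R) : x < y -> exists q : rat, x < ratr q < y.
Proof. by move=> /rat_in_itvoo[q]; rewrite in_itv/= => h; exists q. Qed.

Lemma rational_interval (t M' e eta : R) : M < M' -> 0 < e -> 0 < eta ->
  exists p q : rat,
  [/\ t - eta < ratr p, ratr p < t, t < ratr q & ratr q < t + eta] /\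
  [/\ Phi t - e < Phi (ratr p), Phi (ratr q) < Phi t + e &
      Phi (ratr q) - Phi (ratr p) <= M' * (ratr q - ratr p)].
Proof.
move=> MM' e0 eta0; have M'0 := lt_trans M0 MM'.
have [d d0 hd] := @continuous_eps_delta Phi t e Phi_cont e0.
have [r [r0 rd reta]] : exists r, [/\ 0 < r, r <= d & r <= eta].
  by exists (Num.min d eta); split; rewrite ?lt_min ?d0// ge_min lexx ?orbT.
have r20 : 0 < r / 2 by rewrite divr_gt0.
have [s /andP[s0 sr] hs] := slope t r20.
(* Moving both ends outward to rationals may cost [(M' - M) * s] each in values: [2 * M * s] becomes
   [2 * M' * s], while the length only grows. *)
have e1 : 0 < (M' - M) * s by rewrite mulr_gt0// subr_gt0.
have near u : exists m, [/\ 0 < m, m <= s &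
    forall v, `|v - u| < m -> `|Phi v - Phi u| < (M' - M) * s].
  have [d1 d10 hd1] := @continuous_eps_delta Phi u _ Phi_cont e1.
  exists (Num.min d1 s); split; rewrite ?lt_min ?d10// ?ge_min ?lexx ?orbT//.
  by move=> v; rewrite lt_min => /andP[/hd1].
have [m1 [m10 m1s h1]] := near (t - s); have [m2 [m20 m2s h2]] := near (t + s).
have [p' /andP[p1 p2]] : exists q : rat, t - s - m1 < ratr q < t - s.
  by apply: rat_between; rewrite ltrBlDr ltrDl.
have [q' /andP[q1 q2]] : exists q : rat, t + s < ratr q < t + s + m2.
  by apply: rat_between; rewrite ltrDl.
exists p', q'; move: (ratr p' : R) (ratr q' : R) p1 p2 q1 q2 => p q p1 p2 q1 q2.
have := hd p; have := hd q; have := h1 p; have := h2 q.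
clear hd h1 h2 near slope; clear -s0 sr r0 rd reta m10 m1s m20 m2s p1 p2 q1 q2 M'0 hs.
rewrite !ltr_norml => H1 H2 H3 H4.
have {H1} /andP[_ H1] := H1 ltac:(apply/andP; split; lra).
have {H2} /andP[H2 _] := H2 ltac:(apply/andP; split; lra).
have {H3} /andP[_ H3] := H3 ltac:(apply/andP; split; lra).
have {H4} /andP[H4 _] := H4 ltac:(apply/andP; split; lra).
split; split; try lra.
apply: (@le_trans _ _ (M' * (2 * s))); first by lra.
by rewrite ler_wpM2l ?(ltW M'0)//; lra.
Qed.

(* Vitali's covering theorem is applied on the line of values of [Phi]; the
   symmetric intervals are enlarged to rational ones to get a countable family. *)
Lemma symmetric_slope_le (a b : R) : a < b -> Phi b - Phi a <= M * (b - a).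
Proof.
move=> ab.
suff H (M' eta : R) : M < M' -> 0 < eta -> Phi b - Phi a <= M' * (b - a + 2 * eta).
  have H2 (M' : R) : M < M' -> Phi b - Phi a <= M' * (b - a).
    move=> MM'; have M'0 : 0 < M' by apply: lt_trans M0 MM'.
    apply/ler_addgt0Pr => e e0.
    have e1 : 0 < e / (2 * M') by rewrite divr_gt0// mulr_gt0.
    have := H _ _ MM' e1; rewrite mulrDr.
    by rewrite (_ : M' * (2 * (e / (2 * M'))) = e)//; field; rewrite gt_eqF.
  apply/ler_addgt0Pr => e e0.
  have ba : 0 < b - a by lra.
  have MM' : M < M + e / (b - a) by rewrite ltrDl divr_gt0.
  have := H2 _ MM'; rewrite mulrDl.
  by rewrite (_ : e / (b - a) * (b - a) = e)//; field; rewrite gt_eqF.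
move=> MM' eta0.
pose pq i : rat * rat := odflt (0, 0) (unpickle i).
pose p i : R := ratr (pq i).1; pose q i : R := ratr (pq i).2.
(* The default [ball 0 1] gives every index a positive radius, as [vitali_theorem] requires; [V]
   excludes those indices. *)
pose B i : set R := if p i < q i
  then ball ((Phi (p i) + Phi (q i)) / 2) ((Phi (q i) - Phi (p i)) / 2)
  else ball 0 1.
pose V : set nat := [set i | [/\ p i < q i, a - eta < p i, q i < b + eta &
  Phi (q i) - Phi (p i) <= M' * (q i - p i)]].
have rad i : p i < q i -> 0 < (Phi (q i) - Phi (p i)) / 2.
  by move=> pqi; rewrite divr_gt0// subr_gt0 Phi_incr.
have radB i : p i < q i -> (radius (B i))%:num = (Phi (q i) - Phi (p i)) / 2.
  by move=> pqi; rewrite /B pqi radius_ball_num// ltW// rad.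
have B0 i : 0 < (radius (B i))%:num.
  have [pqi|qp] := ltP (p i) (q i); first by rewrite radB// rad.
  by rewrite /B ifF ?radius_ball_num//; apply/negbTE; rewrite -leNgt.
have Phi_lt s t : Phi s < Phi t -> s < t.
  rewrite ltNge => h; rewrite ltNge; apply: contra h.
  by rewrite le_eqVlt => /orP[/eqP ->//|/Phi_incr/ltW].
have closB i : p i < q i -> closure (B i) = [set` `[Phi (p i), Phi (q i)]].
  move=> pqi; rewrite /B pqi closure_ballE closed_ball_itv ?rad//.
  have -> : (Phi (p i) + Phi (q i)) / 2 - (Phi (q i) - Phi (p i)) / 2 = Phi (p i) by lra.
  by have -> : (Phi (p i) + Phi (q i)) / 2 + (Phi (q i) - Phi (p i)) / 2 = Phi (q i) by lra.
have vit : vitali_cover [set` `[Phi a, Phi b]] B V.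
  split.
    by move=> i; rewrite /B; case: ifP => _; exact: is_ball_ball.
  move=> x /=; rewrite in_itv/= => xI e e0.
  have [t] : exists2 t, t \in `[a, b] & Phi t = x.
    apply: IVT; [exact: ltW|exact: continuous_subspaceT|].
    by rewrite min_l ?max_r ?(ltW (Phi_incr ab)).
  rewrite in_itv/= => /andP[at' tb] Phit.
  have [p' [q' [[p1 p2 q1 q2] [Pe Qe PQ]]]] := rational_interval t MM' e0 eta0.
  pose i := pickle (p', q').
  have pE : p i = ratr p' by rewrite /p /pq pickleK.
  have qE : q i = ratr q' by rewrite /q /pq pickleK.
  have pqi : p i < q i by rewrite pE qE (lt_trans p2).
  have Pp : Phi (p i) < Phi t by apply: Phi_incr; rewrite pE.
  have Pq : Phi t < Phi (q i) by apply: Phi_incr; rewrite qE.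
  exists i; split.
  - split; rewrite ?pE ?qE ?(lt_trans p2)//.
      by apply: le_lt_trans p1; rewrite lerD2r.
    by apply: (lt_le_trans q2); rewrite lerD2r.
  - rewrite /B pqi /ball/= -Phit ltr_norml; move: Pp Pq.
    move: (Phi (p i)) (Phi (q i)) (Phi t) => P Q T PT TQ.
    by apply/andP; split; lra.
  - rewrite radB// pE qE; move: Pe Qe.
    by move: (Phi (ratr p')) (Phi (ratr q')) (Phi t) => P Q T; lra.
have [D [_ DV tD mD]] := vitali_theorem B0 vit.
have mclos i : D i -> measurable (closure (B i)).
  by move=> /DV[pqi _ _ _]; rewrite closB//; exact: measurable_itv.
have mU : measurable (\bigcup_(k in D) closure (B k)) by exact: bigcup_measurable.
have muA : (mu [set` `[Phi a, Phi b]] <= mu (\bigcup_(k in D) closure (B k)))%E.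
  have mA : measurable [set` `[Phi a, Phi b]] by exact: measurable_itv.
  rewrite -[X in mu X](@setUIDK _ _ (\bigcup_(k in D) closure (B k))).
  apply: (le_trans (measureU2 _ _ _)); [exact: measurableI|exact: measurableD|].
  rewrite -[leRHS]adde0; apply: leeD; last by move/eqP: mD; rewrite -measure_le0.
  apply: le_measure; [rewrite inE; exact: measurableI|by rewrite inE|exact: subIsetr].
have muU : (mu (\bigcup_(k in D) closure (B k)) <= (M' * (b - a + 2 * eta))%:E)%E.
  have M'0 : 0 <= M' by apply/ltW/(lt_trans M0 MM').
  rewrite measure_bigcup//.
  (* Disjoint intervals of values come from disjoint parameter intervals, so the latter have total
     length at most that of [[a - eta, b + eta]]. *)
  pose J i : set R := [set` `[p i, q i]].
  have tJ : trivIset D J.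
    move=> i j Di Dj [t [/= ti tj]]; apply: tD => //; exists (Phi t).
    have [pi1 _ _ _] := DV _ Di; have [pj1 _ _ _] := DV _ Dj.
    have mon s s' : s <= s' -> Phi s <= Phi s'.
      by rewrite le_eqVlt => /orP[/eqP -> //|/Phi_incr/ltW].
    move: ti tj; rewrite /J/= !in_itv/= => /andP[i1 i2] /andP[j1 j2].
    by split => /=; rewrite closB//= in_itv/= !mon.
  have JM : (\sum_(0 <= i <oo | i \in D) mu (J i) <= (b - a + 2 * eta)%:E)%E.
    rewrite -measure_bigcup//; last by move=> i _; exact: measurable_itv.
    have -> : (b - a + 2 * eta)%:E = mu [set` `[a - eta, b + eta]].
      rewrite lebesgue_measure_itv/= lte_fin ifT; last by lra.
      by rewrite -EFinB; congr EFin; lra.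
    apply: le_measure; rewrite ?inE.
    - by apply: bigcup_measurable => i _; exact: measurable_itv.
    - exact: measurable_itv.
    - move=> t [i Di /=]; have [_ pa qb _] := DV _ Di.
      by rewrite /J/= !in_itv/= => /andP[i1 i2]; rewrite (ltW (lt_le_trans pa i1)) (ltW (le_lt_trans i2 qb)).
  rewrite EFinM; apply: le_trans (lee_wpmul2l _ JM); last by rewrite lee_fin.
  rewrite -nneseriesZl//; apply: lee_nneseries => // i; rewrite inE => Di.
  have [pq1 _ _ pq2] := DV _ Di.
  rewrite closB// /J lebesgue_measure_itv/= lebesgue_measure_itv/= !lte_fin pq1 Phi_incr//.
have := le_trans muA muU.
rewrite lebesgue_measure_itv/= lte_fin Phi_incr// -EFinB lee_fin; exact.
Qed.

End vitali_slope.

(** * Lower density bound *)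

Section height.
Context {R : realType}.
Implicit Types (a b c : pt R) (u v phi k : R).

Definition latlon u phi : pt R := (cos phi * cos u, cos phi * sin u, sin phi).

(** The latitude, written as [pi / 2] minus the distance to the north pole, which makes it
    1-Lipschitz. *)
Definition height b : R := pi / 2 - acos (pz b).

Lemma S2_latlon u phi : S2 (latlon u phi).
Proof.
rewrite /S2/dot/px/py/pz/=.
rewrite (_ : _ + _ = cos phi ^+ 2 * (cos u ^+ 2 + sin u ^+ 2) + sin phi ^+ 2); last by ring.
by rewrite cos2Dsin2 mulr1 cos2Dsin2.
Qed.

Lemma S1_circ u : S1 (circ u).
Proof.
split => //; rewrite /S2/dot/px/py/pz/= mulr0 addr0 -!expr2; exact: cos2Dsin2.
Qed.

Lemma sigma_circ_le u v : sigma (circ u) (circ v) <= `|u - v|.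
Proof.
apply: acos_le; [by apply: dot_bound; exact: (S1_circ _).1|exact: normr_ge0|].
rewrite cos_norm cosB /dot/px/py/pz/= mulr0 addr0 lexx//.
Qed.

Lemma sigma_circ_latlon u phi : 0 <= phi <= pi -> sigma (circ u) (latlon u phi) = phi.
Proof.
move=> phiI; rewrite /sigma (_ : dot _ _ = cos phi) ?cosK ?in_itv//.
rewrite /dot/px/py/pz/= mul0r addr0.
rewrite (_ : _ + _ = cos phi * (cos u ^+ 2 + sin u ^+ 2)); last by ring.
by rewrite cos2Dsin2 mulr1.
Qed.

Lemma heightE b : height b = pi / 2 - sigma (0, 0, 1) b.
Proof. by rewrite /height /sigma /dot/px/py/pz/= !mul0r !add0r mul1r. Qed.

Lemma S2_pole : S2 ((0, 0, 1) : pt R).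
Proof. by rewrite /S2/dot/px/py/pz/= !mul0r !add0r mul1r. Qed.

Lemma height_Lipschitz a b : S2 a -> S2 b -> height a <= sigma a b + height b.
Proof.
move=> a1 b1; rewrite !heightE; have := sigma_triangle S2_pole a1 b1; lra.
Qed.

Lemma height_le_sigma_equator a c : S2 a -> S1 c -> height a <= sigma a c.
Proof.
move=> a1 [c1 c0]; apply: le_trans (height_Lipschitz a1 c1) _.
by rewrite /height c0 acos0 subrr addr0.
Qed.

Lemma height_ge b y : S2 b -> 0 <= y -> y <= 1 -> y <= pz b -> y <= height b.
Proof.
move=> b1 y0 y1 yb; rewrite /height lerBrDl -lerBrDr.
have pi2 := @pi_ge2 R.
have b1' : -1 <= pz b <= 1.
  by have := S2_sqr_pz b1; have := sqr_ge0 (px b); have := sqr_ge0 (py b);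
    move=> *; apply/andP; split; nra.
apply: acos_le => //; first by lra.
by rewrite -[pi / 2 - y]opprB cosN cosBpihalf (le_trans (sin_le_id y0)).
Qed.

Lemma sin_ge_linear k v : 0 < k -> k < 1 -> 0 <= v -> v <= 1 - k -> k * v <= sin v.
Proof.
move=> k0 k1 v0 vk; apply: le_trans (sin_ge_cubic v0).
by rewrite mulrC ler_wpM2l//; nra.
Qed.

Lemma cos_ge_const k v : 0 < k -> k < 1 -> 0 <= v -> v <= 1 - k -> k <= cos v.
Proof. by move=> k0 k1 v0 vk; apply: le_trans (cos_ge_1B v); nra. Qed.

End height.

Section chart_chains.
Context {R : realType} (g : pt R -> pt R).
Hypothesis gS1 : forall a, S1 a -> S1 (g a).
Implicit Types x y z : Zpt R.
Variables (P : Zpt R -> Prop) (c : Zpt R -> pt R).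
Hypothesis cS2 : forall x, P x -> S2 (c x).
Hypothesis c_in : forall x y, P x -> P y -> ((sigma (c x) (c y))%:E <= Dfun g x y)%E.
Hypothesis c_out : forall x y, P x -> ~ P y -> ((height (c x))%:E <= Dfun g x y)%E.

(* A chain that leaves the open hemisphere [P] must first reach the equator,
   which costs at least the height of its starting point. *)
Lemma min_sigma_height_le_dZ x y : P x -> P y ->
  ((Num.min (sigma (c x) (c y)) (height (c x)))%:E <= dZ g x y)%E.
Proof.
move=> Px Py; apply: le_ereal_inf_tmp => _ [s [_ sy] <-].
elim: s x Px sy => [|z s IHs] x Px /= sy.
  by rewrite sy sigma_refl ?lee_fin ?ge_min ?lexx//; exact: cS2.
have [Pz|nPz] := pselect (P z).
  apply: le_trans (leeD (c_in Px Pz) (IHs _ Pz sy)).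
  rewrite -EFinD lee_fin.
  have := height_Lipschitz (cS2 Px) (cS2 Pz).
  have := sigma_triangle (cS2 Px) (cS2 Pz) (cS2 Py).
  have [h|h] := leP (sigma (c z) (c y)) (height (c z)) => h1 h2.
    by rewrite ge_min h1.
  by rewrite ge_min h2 orbT.
apply: (@le_trans _ _ (height (c x))%:E).
  by rewrite lee_fin ge_min lexx orbT.
by rewrite -[leLHS]adde0; apply: leeD; [exact: c_out|exact: chain_sum_ge0].
Qed.

End chart_chains.

Section density_lower_bound.
Context {R : realType} (g : pt R -> pt R).
(** One argument for both hemispheres: [j] places the open northern hemisphere in [Z], directly or
    after reflection. The seam is parametrized by the longitude on the opposite side, and [Phi]
    turns it into the longitude in the image of [j]. *)
Variables (x : Zpt R) (j : pt R -> Zpt R) (Phi : R -> R) (tau M : R).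
Hypothesis Phi_cont : continuous Phi.
Hypothesis Phi_incr : forall s t, s < t -> Phi s < Phi t.
Hypothesis j_near : forall s phi, 0 < phi -> phi < pi / 2 ->
  (dZ g x (j (latlon (Phi (tau + s)) phi)) <= (`|s| + phi)%:E)%E.
Hypothesis j_far : forall b b', S2 b -> S2 b' -> 0 < pz b -> 0 < pz b' ->
  ((Num.min (sigma b b') (height b))%:E <= dZ g (j b) (j b'))%E.
Variable e0 : R.
Hypothesis e00 : 0 < e0.
Hypothesis slope : forall s, 0 < s -> s < e0 ->
  2 * M * s <= Phi (tau + s) - Phi (tau - s).
Hypothesis M0 : 0 < M.

Let e1 : pt R := (- sin (Phi tau), cos (Phi tau), 0).
Let e2 : pt R := (0, 0, 1).

Let frame v w : dot v w =
  dot (circ (Phi tau)) v * dot (circ (Phi tau)) w + dot e1 v * dot e1 w + dot e2 v * dot e2 w.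
Proof.
have := cos2Dsin2 (Phi tau); rewrite /e1/e2/circ/dot/px/py/pz/=.
move: (cos _) (sin _) => c s cs.
apply/eqP; rewrite eq_sym -subr_eq0.
rewrite (_ : _ - _ = (c ^+ 2 + s ^+ 2 - 1) * (v.1.1 * w.1.1 + v.1.2 * w.1.2)).
  by rewrite cs subrr mul0r.
ring.
Qed.

Let proj_latlon u phi : frame_proj e1 e2 (latlon u phi) = (cos phi * sin (u - Phi tau), sin phi).
Proof.
rewrite /frame_proj/e1/e2/latlon/dot/px/py/pz/= sinB; congr (_, _); ring.
Qed.

(* At height [y], the tent over the image of [[tau - r, tau + r]] contains all
   longitudes [Phi (tau + s)] with [|s| <= r - asin y]. *)
Let slice_cover (k r y : R) : 0 < k -> k < 1 -> 0 < r -> r < e0 -> r <= 1 - k ->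
  (forall s, `|s| <= r -> `|Phi (tau + s) - Phi tau| <= 1 - k) ->
  0 < y -> y <= k * r ->
  exists u0, forall u, u0 <= u <= u0 + 2 * (k * M) * (k * r - y) ->
    exists b, [/\ S2 b, pz b = y, (dZ g x (j b) <= r%:E)%E & frame_proj e1 e2 b = (u, y)].
Proof.
move=> k0 k1 r0 re rk Phir y0 ykr.
have pi2 := @pi_ge2 R.
have y1 : y <= 1 by nra.
have yI : -1 <= y <= 1 by apply/andP; split; lra.
pose phi := asin y.
have sphi : sin phi = y by rewrite /phi asinK// in_itv.
have phiI : phi \in `[- (pi / 2), pi / 2] by rewrite in_itv/= asin_geNpi2// asin_lepi2.
have yk0 : 0 <= y / k by rewrite divr_ge0// ltW.
have ykr' : y / k <= r by rewrite ler_pdivrMr// mulrC.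
have phi_le : phi <= y / k.
  rewrite leNgt -ltr_sin//; last by rewrite in_itv/=; apply/andP; split; lra.
  rewrite -leNgt sphi; have := sin_ge_linear k0 k1 yk0 (le_trans ykr' rk).
  by rewrite mulrC divfK// gt_eqF.
have phi0 : 0 < phi.
  by rewrite -ltr_sin ?sphi ?sin0// in_itv/=; apply/andP; split; lra.
clearbody phi.
have phi2 : phi < pi / 2 by lra.
pose rho := r - phi.
have rho0 : 0 <= rho by rewrite /rho; lra.
have cphi : k <= cos phi by apply: cos_ge_const => //; [exact: ltW|lra].
pose f s := cos phi * sin (Phi (tau + s) - Phi tau).
have fcont : continuous f.
  move=> s; apply: cvgM; first exact: cvg_cst.
  apply: (@continuous_comp _ _ _ (fun s => Phi (tau + s) - Phi tau) sin).
    apply: cvgB; last exact: cvg_cst.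
    apply: (@continuous_comp _ _ _ (fun s => tau + s) Phi); last exact: Phi_cont.
    by apply: cvgD; [exact: cvg_cst|exact: cvg_id].
  exact: continuous_sin.
have mono s t : s <= t -> Phi s <= Phi t.
  by rewrite le_eqVlt => /orP[/eqP -> //|/Phi_incr/ltW].
have len : 2 * (k * M) * (k * r - y) <= f rho - f (- rho).
  have h1 : 2 * (k * M) * (k * r - y) <= k * (k * (2 * M * rho)).
    have : k * phi <= y by rewrite mulrC -ler_pdivlMr.
    rewrite /rho => h; have : 0 <= k * M * (y - k * phi).
      by rewrite !mulr_ge0 ?(ltW k0) ?(ltW M0)// subr_ge0.
    lra.
  apply: (le_trans h1).
  have dp0 : 0 <= Phi (tau + rho) - Phi tau by rewrite subr_ge0 mono// lerDl.
  have dm0 : 0 <= Phi tau - Phi (tau - rho) by rewrite subr_ge0 mono// gerBl.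
  have rr : `|rho| <= r by rewrite ger0_norm// /rho; lra.
  have dpk := Phir rho rr; have dmk := Phir (- rho); rewrite normrN in dmk.
  have {}dmk := dmk rr; rewrite ger0_norm// in dpk; rewrite distrC ger0_norm// in dmk.
  have sp := sin_ge_linear k0 k1 dp0 dpk; have sm := sin_ge_linear k0 k1 dm0 dmk.
  have h2 : 2 * M * rho <= (Phi (tau + rho) - Phi tau) + (Phi tau - Phi (tau - rho)).
    have [->|rhoN0] := eqVneq rho 0; first by rewrite addr0 subr0 subrr; lra.
    rewrite subrKA; apply: slope; first by rewrite lt_neqAle eq_sym rhoN0.
    by rewrite /rho; lra.
  rewrite /f -mulrBr -(opprB (Phi tau) (Phi (tau - rho))) sinN opprK.
  have h3 : k * (2 * M * rho) <= sin (Phi (tau + rho) - Phi tau) + sin (Phi tau - Phi (tau - rho)).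
    apply: le_trans (lerD sp sm); rewrite -mulrDr ler_wpM2l//; exact: ltW.
  apply: ler_pM => //; first exact: ltW.
  by rewrite !mulr_ge0// ltW.
exists (f (- rho)) => u /andP[u1 u2].
have fM : f (- rho) <= f rho.
  rewrite -subr_ge0; apply: le_trans len.
  by rewrite !mulr_ge0 ?(ltW k0) ?(ltW M0)// subr_ge0.
have [s] : exists2 s, s \in `[- rho, rho] & f s = u.
  apply: IVT; [by lra|exact: continuous_subspaceT|].
  rewrite min_l// max_r// u1/=; lra.
rewrite in_itv/= => /andP[s1 s2] fs.
exists (latlon (Phi (tau + s)) phi); split; first exact: S2_latlon.
- by rewrite /pz/= sphi.
- apply: (le_trans (j_near s phi0 phi2)); rewrite lee_fin.
  have : `|s| <= rho by rewrite ler_norml s1 s2.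
  by rewrite /rho; lra.
- by rewrite proj_latlon -/(f s) fs sphi.
Qed.

(** Only the part of the tent above height [y0] is kept. There a set of diameter at most [y0 / 2]
    cannot profit from chains through the equator, so [j_far] bounds spherical distances by [dZ]. *)
Lemma hausdorff2_cballZ_ge (k r : R) : 0 < k -> k < 1 -> 0 < r -> r < e0 -> r <= 1 - k ->
  (forall s, `|s| <= r -> `|Phi (tau + s) - Phi tau| <= 1 - k) ->
  ((M * k ^+ 6 * r ^+ 2)%:E <= hausdorff2 (dZ g) (cballZ g x r))%E.
Proof.
move=> k0 k1 r0 re rk Phir.
(* Chosen so that [k * r - y0 = k ^+ 2 * r]. *)
pose y0 := k * (1 - k) * r.
have y00 : 0 < y0 by rewrite !mulr_gt0// subr_gt0.
pose delta := y0 / 2.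
have delta0 : 0 < delta by rewrite divr_gt0.
apply: (@le_trans _ _ (hausdorff2_delta (dZ g) delta (cballZ g x r))); last first.
  by apply: ereal_sup_ubound; exists delta.
apply: le_ereal_inf_tmp => _ [U [cov small] <-].
pose d i := fine (ediam (dZ g) (U i)).
have ed0 i : (0 <= ediam (dZ g) (U i))%E by apply: ereal_sup_ubound; right.
have edE i : ediam (dZ g) (U i) = (d i)%:E.
  rewrite /d fineK//; apply: fin_real.
  by rewrite (lt_le_trans _ (ed0 i))//= (le_lt_trans (small i))// ltry.
have d0 i : 0 <= d i by rewrite -lee_fin -edE.
have dd i : d i <= delta by rewrite -lee_fin -edE.
pose V i : set (R * R) := [set p | exists b, [/\ S2 b, y0 <= pz b, U i (j b) & frame_proj e1 e2 b = p]].
have Vd i p q : V i p -> V i q -> eucl2 p q <= d i ^+ 2.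
  move=> [b [b1 yb Ub <-]] [b' [b'1 yb' Ub' <-]].
  apply: le_trans (frame_proj_le frame b1 b'1) _.
  rewrite ler_sqr ?nnegrE ?sigma_ge0//.
  have : (dZ g (j b) (j b') <= (d i)%:E)%E.
    by rewrite -edE; apply: ereal_sup_ubound; left; exists (j b) => //; exists (j b').
  move=> /(le_trans (j_far b1 b'1 (lt_le_trans y00 yb) (lt_le_trans y00 yb'))).
  rewrite lee_fin ge_min => /orP[//|h].
  have y01 : y0 <= 1 by rewrite /y0; nra.
  have := height_ge b1 (ltW y00) y01 yb; have := dd i; rewrite /delta; lra.
(* The excess over [pi / 4] needed by [triangle_cover_le] is undone at the end by one more factor
   [k]. *)
have c4 : pi / 4 < pi / (4 * k).
  by rewrite ltr_pM2l ?pi_gt0// ltf_pV2 ?posrE ?mulr_gt0//; lra.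
have ykr : y0 < k * r.
  rewrite /y0 -mulrA ltr_pM2l//; nra.
have kM0 : 0 <= k * M by rewrite mulr_ge0// ltW.
have tri : ((k * M * (k * r - y0) ^+ 2)%:E <= \sum_(i <oo) (pi / (4 * k) * d i ^+ 2)%:E)%E.
  apply: (triangle_cover_le d0 Vd kM0 ykr _ c4) => y /andP[yy0 ykr'].
  have [u0 hu0] := slice_cover k0 k1 r0 re rk Phir (lt_le_trans y00 yy0) ykr'.
  exists u0 => u /hu0[b [b1 yb jb bu]].
  have [i _ Ui] := cov (j b) jb.
  by exists i, b; split => //; rewrite yb.
have -> : (M * k ^+ 6 * r ^+ 2)%:E = (k%:E * (k * M * (k * r - y0) ^+ 2)%:E)%E.
  by rewrite -EFinM; congr EFin; rewrite /y0; ring.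
apply: (@le_trans _ _ (k%:E * \sum_(i <oo) (pi / (4 * k) * d i ^+ 2)%:E)%E).
  by rewrite lee_wpmul2l// lee_fin ltW.
rewrite -nneseriesZl; last first.
  by move=> i _; rewrite lee_fin mulr_ge0 ?sqr_ge0// divr_ge0 ?pi_ge0// mulr_ge0// ltW.
rewrite le_eqVlt; apply/orP; left; apply/eqP; apply: eq_eseriesr => i _.
rewrite -EFinM; congr EFin; rewrite -/(d i).
by move: (pi : R) => P; field; rewrite gt_eqF.
Qed.

Lemma density_gt (C : R) : 0 <= C -> pi * C < M ->
  (C%:E < liminf0 (fun r => hausdorff2 (dZ g) (cballZ g x r) * ((pi * r ^+ 2)^-1)%:E))%E.
Proof.
move=> C0 CM; have pi0 := @pi_gt0 R.
have [|k [k0 k1 Ck]] := @exists_pow_close R 6 (pi * C) M _ CM.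
  by rewrite mulr_ge0// ltW.
have k10 : 0 < 1 - k by lra.
have [d1 d10 hd1] := @continuous_eps_delta R Phi tau _ Phi_cont k10.
pose d := Num.min d1 (Num.min e0 (1 - k)).
have d0 : 0 < d by rewrite !lt_min d10 e00.
apply: (@lt_le_trans _ _ (M * k ^+ 6 / pi)%:E).
  by rewrite lte_fin ltr_pdivlMr// mulrC.
apply: le_ereal_sup_tmp; eexists; first by exists d; [exact: d0|reflexivity].
apply: le_ereal_inf_tmp => _ [r /= /andP[r0 rd] <-].
have [rd1 re rk] : [/\ r < d1, r < e0 & r < 1 - k].
  by move: rd; rewrite !lt_min => /and3P[].
have pr : 0 < pi * r ^+ 2 by rewrite mulr_gt0// exprn_gt0.
have H := hausdorff2_cballZ_ge k0 k1 r0 re (ltW rk) _.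
apply: le_trans (lee_wpmul2r _ (H _)).
- rewrite -EFinM lee_fin le_eqVlt; apply/orP; left; apply/eqP.
  by clear H; move: (pi : R) pi0 => P P0; field; rewrite !gt_eqF.
- by rewrite lee_fin invr_ge0 ltW.
- move=> s sr; apply/ltW/hd1; rewrite addrAC subrr add0r; exact: le_lt_trans sr rd1.
Qed.

End density_lower_bound.

(** * From density to Lipschitz estimates *)

Section circle_lifts.
Context {R : realType}.
Implicit Types (a b : pt R) (s t u v : R).

Lemma S1_is_circ a : S1 a -> exists t, a = circ t.
Proof.
move=> a1; have xy := S1_sqr a1; case: a1 => _ a0.
have xI : -1 <= px a <= 1.
  by have := sqr_ge0 (py a) => ?; apply/andP; split; nra.
have cx : cos (acos (px a)) = px a by rewrite acosK// in_itv.
have sx : sin (acos (px a)) = `|py a|.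
  rewrite sin_acos// -sqrtr_sqr; congr Num.sqrt; lra.
case: a a0 {xy xI} cx sx => [[x y] z]; rewrite /px/py/pz/= => -> cx.
have [y0|y0] := leP 0 y.
  by rewrite ger0_norm// => sx; exists (acos x); rewrite /circ cx sx.
rewrite ltr0_norm// => sx; exists (- acos x).
by rewrite /circ cosN sinN cx sx opprK.
Qed.

(** A representative of [b] whose difference from [t] is exactly the arc length; through it,
    estimates for lifts descend to the circle. Equal cosines leave only the sign of the sine to
    choose. *)
Lemma S1_circ_dist t b : S1 b ->
  exists2 u, b = circ u & `|t - u| = sigma (circ t) b.
Proof.
move=> b1; have [v bv] := S1_is_circ b1; have t1 := S1_circ t.
pose w := v - t; have vE : v = t + w by rewrite /w; ring.
have s0 := sigma_ge0 t1.1 b1.1.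
have cw : cos w = cos (sigma (circ t) b).
  by rewrite cos_sigma ?t1.1 ?b1.1//; [rewrite bv /w cosB /dot/px/py/pz/=; ring|exact: t1.1|exact: b1.1].
clearbody w; move: (sigma (circ t) b) s0 cw => d d0 cw.
have : sin w ^+ 2 = sin d ^+ 2 by rewrite !sin2cos2 cw.
move=> /eqP; rewrite eqf_sqr => /orP[|] /eqP sw.
  exists (t + d); last by rewrite opprD addrA subrr add0r normrN ger0_norm.
  by rewrite bv vE /circ !cosD !sinD sw cw.
exists (t - d); last by rewrite opprB addrCA subrr addr0 ger0_norm.
by rewrite bv vE /circ !cosD !sinD !cosN !sinN sw cw.
Qed.

(** The true gap is [2 * pi], but [pi] is enough to show that the lift is unbounded. *)
Lemma circ_eq_lt u v : circ u = circ v -> u < v -> u + pi <= v.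
Proof.
move=> [cuv suv] uv; rewrite leNgt; apply/negP => vu.
have : sin (v - u) = 0 by rewrite sinB cuv suv; ring.
have : 0 < sin (v - u) by rewrite sin_gt0_pi//; apply/andP; split; lra.
by move=> /gt_eqF/negbT/negP h /eqP.
Qed.

Variables (g : pt R -> pt R) (F : R -> R).
Hypothesis F_cont : continuous F.
Hypothesis F_incr : forall s t, s < t -> F s < F t.
Hypothesis gF : forall t, g (circ t) = circ (F t).

Lemma lift_unbounded n t : F t + n%:R * pi <= F (t + n%:R * (2 * pi)).
Proof.
have pi0 := @pi_gt0 R.
elim: n => [|n IHn]; first by rewrite !mul0r !addr0.
have SE (c : R) : n.+1%:R * c = n%:R * c + c by rewrite -natr1 mulrDl mul1r.
rewrite (SE pi) (SE (2 * pi)) (addrA (F t)) (addrA t); apply: (@le_trans _ _ (F (t + n%:R * (2 * pi)) + pi)).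
  by rewrite lerD2r.
apply: circ_eq_lt; last by apply: F_incr; rewrite ltrDl mulr_gt0.
rewrite -!gF; congr g.
by rewrite /circ (mulr_natl pi 2) cosD2pi sinD2pi.
Qed.

Lemma lift_surj u : exists t, F t = u.
Proof.
have pi1 : 1 <= pi :> R by have := @pi_ge2 R; lra.
pose n := (Num.truncn `|u - F 0|).+1.
have un : `|u - F 0| <= n%:R * pi.
  have /andP[_ /ltW h] := truncn_itv (normr_ge0 (u - F 0)).
  by apply: (le_trans h); rewrite ler_peMr.
have h1 := lift_unbounded n 0; have h2 := lift_unbounded n (- (n%:R * (2 * pi))).
rewrite addNr in h2; rewrite add0r in h1.
move: un; rewrite ler_norml => /andP[u1 u2].
have n0 : 0 <= n%:R * (2 * pi) :> R by rewrite !mulr_ge0//; lra.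
have mono s t : s <= t -> F s <= F t.
  by rewrite le_eqVlt => /orP[/eqP -> //|/F_incr/ltW].
have [||t _ Ft] := @IVT R F (- (n%:R * (2 * pi))) (n%:R * (2 * pi)) u _ (continuous_subspaceT F_cont).
- by lra.
- by rewrite min_l ?max_r ?mono//; first (apply/andP; split); lra.
- by exists t.
Qed.

Lemma lift_inverse : exists E : R -> R, [/\ continuous E,
  forall s t, s < t -> E s < E t, cancel E F & forall t, g (circ (E t)) = circ t].
Proof.
have /choice[E EP] := lift_surj.
have Flt s t : F s < F t -> s < t.
  rewrite ltNge => h; rewrite ltNge; apply: contra h.
  by rewrite le_eqVlt => /orP[/eqP -> //|/F_incr/ltW].
exists E; split => //; last by move=> t; rewrite gF EP.
- move=> u; apply/cvgrPdist_lt => e e0; apply/nbhs_ballP.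
  pose d := Num.min (F (E u + e) - F (E u)) (F (E u) - F (E u - e)).
  have d0 : 0 < d by rewrite lt_min !subr_gt0 !F_incr// ?ltrDl// gtrBl.
  exists d => //= v; rewrite /ball/= distrC lt_min !ltr_norml => /andP[/andP[_ h1] /andP[h2 _]].
  rewrite EP in h1 h2.
  have : E v < E u + e by apply: Flt; rewrite EP; lra.
  have : E u - e < E v by apply: Flt; rewrite EP; lra.
  by move=> ? ?; apply/andP; split; lra.
- by move=> s t st; apply: Flt; rewrite !EP.
Qed.

End circle_lifts.

Section density_to_biLip.
Context {R : realType} (g : pt R -> pt R) (C : R).
Hypothesis gS1 : forall a, S1 a -> S1 (g a).
Hypothesis C0 : 0 <= C.
Hypothesis density : forall x : Zpt R, seam x ->
  (liminf0 (fun r => hausdorff2 (dZ g) (cballZ g x r) * ((pi * r ^+ 2)^-1)%:E) <= C%:E)%E.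

Lemma lift_Lipschitz (Phi : R -> R) : continuous Phi ->
  (forall s t, s < t -> Phi s < Phi t) ->
  (forall tau, exists2 x, seam x & exists j : pt R -> Zpt R,
    (forall s phi, 0 < phi -> phi < pi / 2 ->
      (dZ g x (j (latlon (Phi (tau + s)%R) phi)) <= (`|s| + phi)%:E)%E) /\
    (forall b b', S2 b -> S2 b' -> 0 < pz b -> 0 < pz b' ->
      ((Num.min (sigma b b') (height b))%:E <= dZ g (j b) (j b'))%E)) ->
  forall s t, `|Phi s - Phi t| <= pi * C * `|s - t|.
Proof.
move=> Phi_cont Phi_incr charts.
have piC : 0 <= pi * C by rewrite mulr_ge0// pi_ge0.
have slope (M : R) t e : pi * C < M -> 0 < e ->
    exists2 s, 0 < s < e & Phi (t + s) - Phi (t - s) <= 2 * M * s.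
  move=> CM e0; apply: contrapT => noslope.
  have [x xs [j [j_near j_far]]] := charts t.
  have := density xs; rewrite leNgt => /negP; apply.
  apply: (@density_gt R g x j Phi t M Phi_cont Phi_incr j_near j_far e e0) => //.
  - move=> s s0 se; rewrite leNgt; apply/negP => h; apply: noslope.
    by exists s; [rewrite s0|exact: ltW].
  - exact: le_lt_trans piC CM.
have le1 s t : s < t -> Phi t - Phi s <= pi * C * (t - s).
  move=> st; apply/ler_addgt0Pr => e e0.
  have ts : 0 < t - s by rewrite subr_gt0.
  have CM : pi * C < pi * C + e / (t - s) by rewrite ltrDl divr_gt0.
  have := symmetric_slope_le Phi_cont Phi_incr (le_lt_trans piC CM)
    (fun t e => slope _ t e CM) st.
  rewrite mulrDl.
  by rewrite (_ : e / (t - s) * (t - s) = e)//; field; rewrite gt_eqF.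
move=> s t; have [st|ts|->] := ltgtP s t; last by rewrite !subrr normr0 mulr0.
- by rewrite distrC (distrC s) !gtr0_norm ?subr_gt0 ?Phi_incr//; exact: le1.
- by rewrite !gtr0_norm ?subr_gt0 ?Phi_incr//; exact: le1.
Qed.

Lemma inZ_seam (t : R) : inZ (false, circ t).
Proof. by split; [exact: (S1_circ t).1|rewrite /= lexx]. Qed.

Let seam_pt t : Zpt R := exist _ _ (inZ_seam t).

Let seam_ptP t : seam (seam_pt t).
Proof. by []. Qed.

Let north (x : Zpt R) (b : pt R) : Zpt R :=
  if pselect (inZ (true, b)) is left h then exist _ (true, b) h else x.

Let reflect (b : pt R) : pt R := (px b, py b, - pz b).

Let south (x : Zpt R) (b : pt R) : Zpt R :=
  if pselect (inZ (false, reflect b)) is left h then exist _ (false, reflect b) h else x.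

Let sval_north x b : S2 b -> 0 < pz b -> sval (north x b) = (true, b).
Proof. by rewrite /north; case: pselect => //= + b1 b0; case. Qed.

Let S2_reflect b : S2 b -> S2 (reflect b).
Proof. by rewrite /S2/dot/reflect/px/py/pz/= mulrNN. Qed.

Let sigma_reflect a b : sigma (reflect a) (reflect b) = sigma a b.
Proof. by rewrite /sigma/dot/reflect/px/py/pz/= mulrNN. Qed.

Let reflectK b : reflect (reflect b) = b.
Proof. by case: b => [[x y] z]; rewrite /reflect/px/py/pz/= opprK. Qed.

Let sval_south x b : S2 b -> 0 < pz b -> sval (south x b) = (false, reflect b).
Proof.
rewrite /south; case: pselect => //= + b1 b0; case.
by split; [exact: S2_reflect|rewrite /reflect/pz/= oppr_le0; exact: ltW].
Qed.

Let north_far x b b' : S2 b -> S2 b' -> 0 < pz b -> 0 < pz b' ->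
  ((Num.min (sigma b b') (height b))%:E <= dZ g (north x b) (north x b'))%E.
Proof.
move=> b1 b'1 b0 b'0.
have := @min_sigma_height_le_dZ R g gS1 (fun z => (sval z).1 = true) (fun z => (sval z).2)
  _ _ _ (north x b) (north x b').
rewrite !sval_north//=; apply => //.
- by move=> z _; exact: S2_Zpt.
- move=> [[i u] [/= u1 iu]] [[i' v] [/= v1 iv]]; rewrite /Dfun/= => -> ->; exact: lexx.
- move=> [[i u] [/= u1 iu]] [[i' v] [/= v1 iv]]; rewrite /Dfun/= => ->.
  case: i' iv => /= iv h; first by case: h.
  case: ifPn => [/eqP v0|_]; last exact: leey.
  by rewrite lee_fin height_le_sigma_equator//; apply: gS1.
Qed.

(** The predicate leaves out the seam: between two seam points [Dfun] is a minimum that may lie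
    below the southern distance. *)
Let south_far x b b' : S2 b -> S2 b' -> 0 < pz b -> 0 < pz b' ->
  ((Num.min (sigma b b') (height b))%:E <= dZ g (south x b) (south x b'))%E.
Proof.
move=> b1 b'1 b0 b'0.
have := @min_sigma_height_le_dZ R g gS1 (fun z => (sval z).1 = false /\ pz (sval z).2 < 0)
  (fun z => reflect (sval z).2) _ _ _ (south x b) (south x b').
rewrite !sval_south//= !reflectK; apply => //.
- by move=> z _; apply/S2_reflect/S2_Zpt.
- move=> [[i u] [/= u1 iu]] [[i' v] [/= v1 iv]]; rewrite /Dfun/= => -[-> u0] [-> v0].
  by rewrite (lt_eqF u0)/= sigma_reflect.
- move=> [[i u] [/= u1 iu]] [[i' v] [/= v1 iv]]; rewrite /Dfun/= => -[-> u0].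
  case: i' iv => /= iv h; rewrite (lt_eqF u0)/=; first exact: leey.
  have v0 : pz v = 0.
    by apply/eqP; rewrite eq_le iv leNgt; apply/negP => v0; apply: h.
  rewrite lee_fin -(sigma_reflect u v); apply: height_le_sigma_equator; first exact: S2_reflect.
  by split; [exact: S2_reflect|rewrite /reflect/pz/= -/(pz v) v0 oppr0].
- by split => //; rewrite {1}/pz/= oppr_lt0.
- by split => //; rewrite {1}/pz/= oppr_lt0.
Qed.

Variable F : R -> R.
Hypothesis F_cont : continuous F.
Hypothesis F_incr : forall s t, s < t -> F s < F t.
Hypothesis gF : forall t, g (circ t) = circ (F t).

Let phi_pi (phi : R) : 0 < phi -> phi < pi / 2 -> 0 <= phi <= pi.
Proof. by have := @pi_gt0 R => *; apply/andP; split; lra. Qed.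

Let sin_phi (phi : R) : 0 < phi -> phi < pi / 2 -> 0 < sin phi.
Proof. by have := @pi_gt0 R => *; rewrite sin_gt0_pi//; apply/andP; split; lra. Qed.

(** Northern tents: a seam point is reached along the southern arc, of length at most [|u|], and
    then left along the northern meridian of longitude [F (tau + u)]. *)
Lemma forward_Lipschitz s t : `|F s - F t| <= pi * C * `|s - t|.
Proof.
apply: lift_Lipschitz => // tau; exists (seam_pt tau) => //.
exists (north (seam_pt tau)); split; last exact: north_far.
move=> u phi phi0 phi2.
apply: (le_trans (dZ_le_Dfun2 _ _ (seam_pt (tau + u)) _)).
rewrite EFinD; apply: leeD.
  rewrite /Dfun/= eqxx/= lee_fin ge_min (le_trans (sigma_circ_le _ _))//.
  by rewrite opprD addrA subrr add0r normrN.
rewrite /Dfun sval_north/= ?eqxx ?sin_phi//; last exact: S2_latlon.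
by rewrite gF sigma_circ_latlon// phi_pi.
Qed.

(** Southern tents: the seam is parametrized by northern longitude, the other term of the minimum in
    [Dfun] gives the cost, and the meridian climbed has longitude [E (tau + u)]. *)
Lemma backward_Lipschitz s t : `|s - t| <= pi * C * `|F s - F t|.
Proof.
have [E [E_cont E_incr EK gE]] := lift_inverse F_cont F_incr gF.
have KE u : E (F u) = u.
  have := EK (F u); have [h|h|//] := ltgtP (E (F u)) u.
    by move=> e; have := F_incr h; rewrite e ltxx.
  by move=> e; have := F_incr h; rewrite e ltxx.
rewrite -{1}(KE s) -{1}(KE t).
apply: (lift_Lipschitz E_cont E_incr) => tau; exists (seam_pt (E tau)) => //.
exists (south (seam_pt (E tau))); split; last exact: south_far.
move=> u phi phi0 phi2.
apply: (le_trans (dZ_le_Dfun2 _ _ (seam_pt (E (tau + u))) _)).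
rewrite EFinD; apply: leeD.
  rewrite /Dfun/= eqxx/= lee_fin ge_min !gE (le_trans (sigma_circ_le (tau) _)) ?orbT//.
  by rewrite opprD addrA subrr add0r normrN.
have l2 := S2_latlon (E (tau + u)) phi.
rewrite /Dfun sval_south ?sin_phi//= eqxx/=.
rewrite oppr_eq0 gt_eqF ?sin_phi//.
have -> : circ (E (tau + u)) = reflect (circ (E (tau + u))).
  by rewrite /reflect/circ/px/py/pz/= oppr0.
by rewrite sigma_reflect sigma_circ_latlon// phi_pi.
Qed.

Lemma biLip_of_density : (forall a b, S1 a -> S1 b -> g a = g b -> a = b) ->
  circle_biLip g (pi * C).
Proof.
move=> g_inj a b a1 b1; have [t at'] := S1_is_circ a1; subst a.
have piC : 0 <= pi * C by rewrite mulr_ge0// pi_ge0.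
split; last first.
  have [u bu <-] := S1_circ_dist t b1; rewrite bu !gF.
  exact: le_trans (sigma_circ_le _ _) (forward_Lipschitz _ _).
have [v gbv] := S1_circ_dist (F t) (gS1 b1); rewrite -gF => <-.
have [u Fu] := lift_surj F_cont F_incr gF v.
have -> : b = circ u by apply: g_inj => //; [exact: S1_circ|rewrite gF Fu].
by rewrite -Fu; apply: le_trans (sigma_circ_le _ _) (backward_Lipschitz _ _).
Qed.

End density_to_biLip.

Theorem theorem1p1 (R : realType) (g : pt R -> pt R)
  (hg : circle_homeo g) (hor : orientation_preserving g) :
  [/\ (* (1) => (2) with L' = L *)
      (forall L : R, circle_biLip g L ->
         exists psi : Zpt R -> pt R, biLip_homeo_to_S2 g psi L),
      (* (2) => (3) with C' = L'^4 *)
      (forall (L' : R) (psi : Zpt R -> pt R), biLip_homeo_to_S2 g psi L' ->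
         forall x : Zpt R, seam x ->
           (liminf0 (fun r => hausdorff2 (dZ g) (cballZ g x r)
                              * ((pi * r ^+ 2)^-1)%:E) <= (L' ^+ 4)%:E)%E) &
      (* (3) => (1) with L = pi * C' *)
      (forall C' : R, 0 <= C' ->
         (forall x : Zpt R, seam x ->
           (liminf0 (fun r => hausdorff2 (dZ g) (cballZ g x r)
                              * ((pi * r ^+ 2)^-1)%:E) <= C'%:E)%E) ->
         circle_biLip g (pi * C'))].
Proof.
have [gS1 g_surj g_inj _ _] := hg; have [F [F_cont F_incr gF]] := hor.
split.
- by move=> L gL; exists (gluing_chart g); exact: biLip_homeo_gluing_chart.
- by move=> L' psi psiL x _; exact: density_le psiL x.
- by move=> C' C0 dens; exact: biLip_of_density gF g_inj.
Qed.
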